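(* (i) There exist a C*-algebra $A$ and compact projections $p,q\in A^{**}$ such that, with $F=\ \uparrow\! p$ and $G=\ \uparrow\! q$, $$\inf_{a\in F}\sup_{b\in G}\mathbf{d}(a,b)=0\qquad\text{but}\qquad p\not\le q^\circ.$$ (ii) There exists a C*-algebra $A$ such that, on the compact projections of $A^{**}$, $\mathbf{c}\not\precapprox\mathbf{c}\circ\mathbf{e}$.
   Context: $A^{**}$ is the enveloping von Neumann algebra of $A$, with $A\subseteq A^{**}$. $A^1_+$ is the set of positive elements of $A$ of norm at most $1$, and $\mathbf{d}(a,b)=\|a-ab\|$. For a projection $p\in A^{**}$ let $\uparrow\! p=\{a\in A^1_+:p\le a\}$ and $\downarrow\! p=\{a\in A^1_+:a\le p\}$. $\bigwedge$ and $\bigvee$ denote infimum and supremum in the self-adjoint part of $A^{**}$. A projection $p$ is compact if $\uparrow\! p\neq\emptyset$ and $p=\bigwedge\uparrow\! p$; it is open if $p=\bigvee\downarrow\! p$. The interior of a projection $p$ is $p^\circ=\bigvee\downarrow\! p$, the largest open projection below $p$. On compact projections of $A^{**}$ put $\mathbf{c}(p,q)=\|p-pq^\circ\|$ and $\mathbf{e}(p,q)=\|p-q\|$, and $(\mathbf{c}\circ\mathbf{e})(p,q)=\inf_{r}(\mathbf{c}(p,r)+\mathbf{e}(r,q))$, where $r$ ranges over the compact projections of $A^{**}$. For functions $\mathbf{F},\mathbf{G}:X\to[0,\infty]$ on a set $X$, $\mathbf{F}\precapprox\mathbf{G}$ means $\lim_{r\to0}\sup_{\mathbf{G}(x)\le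 r}\mathbf{F}(x)=0$, i.e. for every $\epsilon>0$ there is $\delta>0$ such that $\mathbf{G}(x)<\delta$ implies $\mathbf{F}(x)<\epsilon$ for all $x\in X$ (here $X$ is the set of pairs of compact projections). *)

(* Defs.v *)
From HB Require Import structures.
From mathcomp Require Import all_boot all_order all_algebra.
From mathcomp Require Import sesquilinear complex.
From mathcomp Require Import all_classical all_reals all_analysis.
Set Implicit Arguments.
Unset Strict Implicit.
Unset Printing Implicit Defensive.
Import Order.TTheory GRing.Theory Num.Theory.
Import numFieldNormedType.Exports.
Local Open Scope classical_set_scope.
Local Open Scope ring_scope.
Local Open Scope complex_scope.

(* The norm of a complex normed space takes its values in [R[i]], on the
   nonnegative real axis; [rnorm] is the same number as an element of [R]. *)
Definition rnorm (R : realType) (V : normedModType R[i]) (x : V) : R :=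
  complex.Re `|x|.

Definition opnorm (R : realType) (V W : normedModType R[i]) (f : V -> W) :
    \bar R :=
  ereal_sup [set (rnorm (f x))%:E | x in [set x : V | `|x| <= 1]].

(* Not necessarily unital. *)
Record cstarAlgebra (R : realType) := CStarAlgebra {
  cs_sort :> completeNormedModType R[i];
  cs_mul : cs_sort -> cs_sort -> cs_sort;
  cs_star : cs_sort -> cs_sort;
  cs_mulA : associative cs_mul;
  cs_mulDl : left_distributive cs_mul +%R;
  cs_mulDr : right_distributive cs_mul +%R;
  cs_scaleAl : forall (k : R[i]) a b, cs_mul (k *: a) b = k *: cs_mul a b;
  cs_scaleAr : forall (k : R[i]) a b, cs_mul a (k *: b) = k *: cs_mul a b;
  cs_normM : forall a b, `|cs_mul a b| <= `|a| * `|b|;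
  cs_starK : involutive cs_star;
  cs_starD : forall a b, cs_star (a + b) = cs_star a + cs_star b;
  cs_starZ : forall (k : R[i]) a, cs_star (k *: a) = k^* *: cs_star a;
  cs_starM : forall a b, cs_star (cs_mul a b) = cs_mul (cs_star b) (cs_star a);
  cs_norm_star : forall a, `|cs_mul (cs_star a) a| = `|a| ^+ 2
}.

Record hilbertSpace (R : realType) := HilbertSpace {
  hs_sort :> completeNormedModType R[i];
  hs_inner : {dot hs_sort for (@Num.conj R[i])};
  hs_normE : forall x : hs_sort, `|x| ^+ 2 = hs_inner x x
}.

Section CStar.
Context {R : realType} (A : cstarAlgebra R).

Definition positive_elt (a : A) := exists b : A, a = cs_mul (cs_star b) b.

Definition pos_ball : set A := [set a | positive_elt a /\ `|a| <= 1].

Definition state (phi : A -> R[i]) :=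
  [/\ linear (phi : A -> R[i]^o),
      forall a, 0 <= phi (cs_mul (cs_star a) a)
    & opnorm (phi : A -> R[i]^o) = 1%E].

Definition dA (a b : A) : R := rnorm (a - cs_mul a b).

End CStar.

Section Operators.
Context {R : realType} (H : hilbertSpace R).

Definition bounded_op (T : H -> H) :=
  linear T /\ exists M : R[i], forall x, `|T x| <= M * `|x|.

Definition selfadjoint_op (T : H -> H) :=
  forall x y, hs_inner H (T x) y = hs_inner H x (T y).

(* The order [S <= T] of operators; the order of [R[i]] makes [0 <= z] say that
   [z] is real and nonnegative. *)
Definition op_le (S T : H -> H) :=
  forall x, 0 <= hs_inner H (T x - S x) x.

Definition commutant (X : set (H -> H)) : set (H -> H) :=
  [set T | bounded_op T /\ forall S, X S -> T \o S = S \o T].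

Definition representation (A : cstarAlgebra R) (pi : A -> H -> H) :=
  [/\ forall a, bounded_op (pi a),
      forall (k : R[i]) a b x, pi (k *: a + b) x = k *: pi a x + pi b x,
      forall a b x, pi (cs_mul a b) x = pi a (pi b x)
    & forall a x y, hs_inner H (pi (cs_star a) x) y = hs_inner H x (pi a y)].

End Operators.

(* The universal representation of [A]: the Hilbert space direct sum, over all
   the states [phi] of [A], of the GNS representations of [A].  The summand of
   [phi] is the closed invariant subspace [ur_gns phi], with cyclic vector
   [ur_vec phi] such that [<pi(a) xi, xi> = phi a].  These data determine the
   representation up to unitary equivalence.  The value of [ur_vec] is
   irrelevant at a function that is not a state. *)
Record universalRep (R : realType) (A : cstarAlgebra R) := UniversalRep {
  ur_space : hilbertSpace R;
  ur_rep : A -> ur_space -> ur_space;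
  ur_vec : (A -> R[i]) -> ur_space;
  ur_gns (phi : A -> R[i]) : set ur_space :=
    closure (range (fun a => ur_rep a (ur_vec phi)));
  ur_repP : representation ur_rep;
  ur_cyclic : forall phi, state phi -> ur_gns phi (ur_vec phi);
  ur_state : forall phi, state phi -> forall a,
    hs_inner ur_space (ur_rep a (ur_vec phi)) (ur_vec phi) = phi a;
  ur_orthogonal : forall phi psi, state phi -> state psi -> phi <> psi ->
    forall x y, ur_gns phi x -> ur_gns psi y -> hs_inner ur_space x y = 0;
  ur_total : closure
    [set x : ur_space | exists (n : nat) (phi : 'I_n -> A -> R[i])
                          (v : 'I_n -> ur_space),
       (forall i, state (phi i) /\ ur_gns (phi i) (v i)) /\
       x = \sum_(i < n) v i] = setT
}.

Section Enveloping.
Context {R : realType} {A : cstarAlgebra R} (U : universalRep A).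
Local Notation H := (ur_space U).
Local Notation iota := (@ur_rep R A U).

(* [A^**], the bicommutant of [A] in its universal representation; [A] is
   regarded as a subset of it through [ur_rep], which is isometric. *)
Definition enveloping : set (H -> H) := commutant (commutant (range iota)).

Definition enveloping_sa : set (H -> H) :=
  enveloping `&` [set T | selfadjoint_op T].

Definition projection (p : H -> H) := enveloping_sa p /\ p \o p = p.

Definition is_inf (X : set (H -> H)) (x : H -> H) :=
  [/\ enveloping_sa x, forall y, X y -> op_le x y
    & forall z, enveloping_sa z -> (forall y, X y -> op_le z y) -> op_le z x].

Definition is_sup (X : set (H -> H)) (x : H -> H) :=
  [/\ enveloping_sa x, forall y, X y -> op_le y x
    & forall z, enveloping_sa z -> (forall y, X y -> op_le y z) -> op_le x z].

Definition up (p : H -> H) : set A := [set a | pos_ball a /\ op_le p (iota a)].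

Definition down (p : H -> H) : set A :=
  [set a | pos_ball a /\ op_le (iota a) p].

Definition compact_proj : set (H -> H) :=
  [set p | [/\ projection p, up p !=set0 & is_inf (iota @` up p) p]].

(* For a projection [p] this supremum exists, and it is unique, so that the
   default value [0] of [xget] is never taken for want of a supremum. *)
Definition interior_proj (p : H -> H) : H -> H :=
  xget (fun=> 0) [set x | is_sup (iota @` down p) x].

Definition c_dist (p q : H -> H) : \bar R :=
  opnorm (p \- (p \o interior_proj q)).

Definition e_dist (p q : H -> H) : \bar R := opnorm (p \- q).

Definition ce_dist (p q : H -> H) : \bar R :=
  ereal_inf [set (c_dist p r + e_dist r q)%E | r in compact_proj].

End Enveloping.

Arguments enveloping {R A} U.
Arguments enveloping_sa {R A} U.
Arguments projection {R A} U p.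
Arguments is_inf {R A} U X x.
Arguments is_sup {R A} U X x.
Arguments up {R A} U p.
Arguments down {R A} U p.
Arguments compact_proj {R A} U.
Arguments interior_proj {R A} U p.
Arguments c_dist {R A} U p q.
Arguments e_dist {R A} U p q.
Arguments ce_dist {R A} U p q.

(* [F] is approximately dominated by [G] on the set [X]. *)
Definition precapprox (R : realType) (T : Type) (X : set T) (F G : T -> \bar R) :=
  forall eps : R, 0 < eps -> exists2 delta : R, 0 < delta &
    forall x, X x -> (G x < delta%:E)%E -> (F x < eps%:E)%E.

(* Main.v *)
(** Let [A] be the algebra of the bounded functions [a] from the points [(k, n)]
    and [oo] to the 2x2 matrices such that [a (k, n) - a (k, n + 1)] tends to [0]
    as [n] grows, for each [k], and [a (k, n)] tends to [a oo] as [k] grows,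
    uniformly in [n].  Let [e1] be the first basis vector.  Consider the following
    projections of the enveloping algebra, each the infimum of a decreasing
    sequence of projections of [A], and hence compact:
    - [p] is the infimum over [N] of the functions equal to [e1 e1^*] at [oo] and
      at [(k, n)] with [k >= N], and to [0] elsewhere;
    - [q^K] is the largest projection whose value at [(k, n)] is the projection
      onto the line of [(1, t)] or [(1, -t)], according to the parity of [n], with
      [t = 1 / (k + K + 1)];
    - [r] is the largest projection whose value at every [(k, n)] is [e1 e1^*].

    If [a <= q^K] is positive, then its consecutive values lie below two distinct
    lines and get closer as [n] grows; so [a (k, n) e1] tends to [0], and
    [a oo e1 = 0].  Hence the interior of [q^K] is orthogonal to [p].  Yet the
    [N]-th function defining [p] is almost absorbed by every [b >= q^0] as [N]
    grows, and [p] lies below the constant function [e1 e1^*], which is the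
    interior of [r], while the distance from [r] to [q^K] is at most
    [1 / (K + 1)].

    The universal representation acts on the completion of the finitely
    supported functions from the states to [A]; the enveloping algebra need not
    be computed. *)

From HB Require Import structures.
From mathcomp Require Import all_boot all_order all_algebra.
From mathcomp Require Import sesquilinear complex ring lra.
From mathcomp Require Import all_classical all_reals all_analysis.
Require Import Defs.
Set Implicit Arguments.
Unset Strict Implicit.
Unset Printing Implicit Defensive.
Import Order.TTheory GRing.Theory Num.Theory.
Import numFieldNormedType.Exports.
Local Open Scope classical_set_scope.
Local Open Scope ring_scope.

Local Notation "x %:C" := (real_complex _ x) : ring_scope.
Local Notation "R [i]" := (complex R) : type_scope.
Local Notation "x +i* y" := (Complex x y) : ring_scope.
Local Notation normc := (@ComplexField.Normc.normc _).

(** * Spaces of functions with a weighted supremum norm *)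

Section ComplexModulus.
Context {R : realType}.
Implicit Types x y z : R[i].

Lemma normcE z : `|z| = (normc z)%:C. Proof. by []. Qed.

Lemma normc_ge0 z : 0 <= normc z.
Proof. by rewrite -lecR -normcE normr_ge0. Qed.

Lemma normcD x y : normc (x + y) <= normc x + normc y.
Proof. exact: le_normcD. Qed.

Lemma normcB x y : normc (x - y) = normc (y - x).
Proof. by apply: complexI; rewrite -!normcE distrC. Qed.

Lemma normc_conj z : normc z^* = normc z.
Proof. by case: z => a b /=; rewrite sqrrN. Qed.

Lemma conj_realC (r : R) : (r%:C)^* = r%:C.
Proof. exact: conjc_real. Qed.

Lemma normc_real (r : R) : normc r%:C = `|r|.
Proof. by rewrite /= expr0n addr0 sqrtr_sqr. Qed.

Lemma Re_le_normc z : complex.Re z <= normc z.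
Proof.
case: z => a b /=; apply: (le_trans (ler_norm a)).
by rewrite -sqrtr_sqr ler_wsqrtr// lerDl sqr_ge0.
Qed.

Lemma normc_triangle x y z : normc (x - z) <= normc (x - y) + normc (y - z).
Proof. by rewrite -[x - z](subrKA y); exact: normcD. Qed.

Lemma ge0_Re (z : R[i]) : 0 <= z -> (complex.Re z)%:C = z /\ 0 <= complex.Re z.
Proof. by case: z => a b; rewrite lecE /= => /andP[/eqP -> ->]. Qed.

End ComplexModulus.

(** The intervals of centre [r n] and radius [e n] meet pairwise, so the supremum of their left ends
    belongs to all of them. *)
Lemma approx_limit_real (R : realType) (r e : nat -> R) :
  (forall n m, `|r n - r m| <= e n + e m) ->
  exists c, forall n, `|c - r n| <= e n.
Proof.
move=> H; pose E := [set r n - e n | n in setT].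
have ub m : ubound E (r m + e m).
  by move=> _ [n _ <-]; have := H n m; rewrite ler_norml => /andP[_]; lra.
have Es : has_sup E by split; [exists (r 0%N - e 0%N); exists 0%N | exists (r 0%N + e 0%N)].
exists (sup E) => n; rewrite ler_norml.
have h1 : r n - e n <= sup E by apply: sup_upper_bound => //; exists n.
have h2 : sup E <= r n + e n by apply: ge_sup; [case: Es | exact: ub].
by apply/andP; split; lra.
Qed.

(* The factor [2] is the price of treating the two coordinates separately. *)
Lemma approx_limit (R : realType) (u : nat -> R[i]) (e : nat -> R) :
  (forall n m, normc (u n - u m) <= e n + e m) ->
  exists c, forall n, normc (c - u n) <= 2 * e n.
Proof.
move=> H.
have le_re (z : R[i]) : `|complex.Re z| <= normc z /\ `|complex.Im z| <= normc z.
  case: z => a b /=; rewrite -2!sqrtr_sqr; split; apply: ler_wsqrtr.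
    by rewrite lerDl sqr_ge0.
  by rewrite lerDr sqr_ge0.
have [a ha] : exists c, forall n, `|c - complex.Re (u n)| <= e n.
  apply: approx_limit_real => n m; apply: le_trans (H n m).
  by have := (le_re (u n - u m)).1; case: (u n) (u m) => ? ? [].
have [b hb] : exists c, forall n, `|c - complex.Im (u n)| <= e n.
  apply: approx_limit_real => n m; apply: le_trans (H n m).
  by have := (le_re (u n - u m)).2; case: (u n) (u m) => ? ? [].
exists (a +i* b) => n.
have -> : (a +i* b) - u n
    = (a - complex.Re (u n))%:C + 'i%C * (b - complex.Im (u n))%:C.
  by case: (u n) => ? ?; apply/eqP; rewrite eq_complex /=; apply/andP; split; apply/eqP; ring.
apply: (le_trans (normcD _ _)).
rewrite ComplexField.Normc.normcM !normc_real /= expr0n expr1n add0r sqrtr1.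
by have := ha n; have := hb n; lra.
Qed.

(* A space of functions [ev w] on an index set, bounded relative to the weight
   [rho] and closed under uniform limits relative to [rho]. *)
Record normData (R : realType) := NormData {
  nd_sort : lmodType R[i];
  nd_idx : Type;
  nd_ev : nd_sort -> nd_idx -> R[i];
  nd_rho : nd_idx -> R;
  nd_lin : forall k w1 w2 x,
    nd_ev (k *: w1 + w2) x = k * nd_ev w1 x + nd_ev w2 x;
  nd_rho_ge0 : forall x, 0 <= nd_rho x;
  nd_bnd : forall w, exists M, 0 <= M /\
    forall x, normc (nd_ev w x) <= M * nd_rho x;
  nd_inj : forall w, (forall x, nd_ev w x = 0) -> w = 0;
  nd_closed : forall g : nd_idx -> R[i],
    (forall e, 0 < e -> exists w, forall x,
       normc (g x - nd_ev w x) <= e * nd_rho x) ->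
    exists w, nd_ev w = g
}.

Definition wspace (R : realType) (D : normData R) : Type := nd_sort D.

Section WeightedNorm.
Context {R : realType} (D : normData R).
Implicit Types w : wspace D.

HB.instance Definition _ := GRing.Lmodule.on (wspace D).

Definition wbnd w : set R :=
  [set M | 0 <= M /\ forall x, normc (nd_ev w x) <= M * nd_rho x].

(** An infimum of admissible constants is used rather than a supremum of quotients, because the
    weight may vanish. *)
Definition wnorm w : R := inf (wbnd w).

Let wbnd_inf w : has_inf (wbnd w).
Proof. by split; [have [M] := nd_bnd w; exists M | exists 0 => M []]. Qed.

Lemma wnorm_le w M : 0 <= M ->
  (forall x, normc (nd_ev w x) <= M * nd_rho x) -> wnorm w <= M.
Proof. by move=> M0 wM; apply: ge_inf; [case: (wbnd_inf w) | split]. Qed.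

Lemma wnorm_ge0 w : 0 <= wnorm w.
Proof. by apply: lb_le_inf; [case: (wbnd_inf w) | move=> M []]. Qed.

(** The infimum is itself admissible: where the weight vanishes so does the value, and elsewhere one
    divides by the weight. *)
Lemma wnormP w x : normc (nd_ev w x) <= wnorm w * nd_rho x.
Proof.
have := nd_rho_ge0 x; rewrite le_eqVlt => /orP[/eqP r0|r0].
  by have [M [_ /(_ x)]] := nd_bnd w; rewrite -r0 !mulr0.
rewrite -ler_pdivrMr//; apply: lb_le_inf; first by case: (wbnd_inf w).
by move=> M [_ /(_ x)]; rewrite ler_pdivrMr.
Qed.

Let evD w1 w2 x : nd_ev (w1 + w2 : wspace D) x = nd_ev w1 x + nd_ev w2 x.
Proof. by have := nd_lin 1 w1 w2 x; rewrite scale1r mul1r. Qed.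

Let ev0 x : nd_ev (0 : wspace D) x = 0.
Proof. by apply: (addrI (nd_ev (0 : wspace D) x)); rewrite -evD !addr0. Qed.

Let evZ k w x : nd_ev (k *: w : wspace D) x = k * nd_ev w x.
Proof. by have := nd_lin k w 0 x; rewrite addr0 [nd_ev 0 x]ev0 addr0. Qed.

Let evB w1 w2 x : nd_ev (w1 - w2 : wspace D) x = nd_ev w1 x - nd_ev w2 x.
Proof. by rewrite evD -scaleN1r evZ mulN1r. Qed.

Let wnormD w1 w2 : (wnorm (w1 + w2))%:C <= (wnorm w1)%:C + (wnorm w2)%:C.
Proof.
rewrite -rmorphD lecR; apply: wnorm_le; first by rewrite addr_ge0 ?wnorm_ge0.
move=> x; rewrite evD mulrDl; apply: (le_trans (normcD _ _)).
by apply: lerD; exact: wnormP.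
Qed.

Let wnormZ_le k w : wnorm (k *: w) <= normc k * wnorm w.
Proof.
apply: wnorm_le; first by rewrite mulr_ge0 ?wnorm_ge0 ?normc_ge0.
move=> x; rewrite evZ ComplexField.Normc.normcM -mulrA.
by rewrite ler_wpM2l ?normc_ge0// wnormP.
Qed.

Let wnorm0_eq0 w : (wnorm w)%:C = 0 -> w = 0.
Proof.
move=> /complexI w0; apply: nd_inj => x; apply: ComplexField.Normc.eq0_normc.
by apply/eqP; rewrite eq_le normc_ge0 andbT (le_trans (wnormP w x))// w0 mul0r.
Qed.

Let wnormZ k w : (wnorm (k *: w))%:C = `|k| * (wnorm w)%:C.
Proof.
rewrite normcE -rmorphM; congr (_%:C); apply/eqP; rewrite eq_le wnormZ_le /=.
have [->|k0] := eqVneq k 0.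
  by rewrite ComplexField.Normc.normc0 mul0r wnorm_ge0.
rewrite -[w in leLHS](scalerK k0) (le_trans (ler_wpM2l (normc_ge0 _) (wnormZ_le _ _)))//.
rewrite mulrA -ComplexField.Normc.normcM divff//.
by rewrite ComplexField.Normc.normc1 mul1r.
Qed.

HB.instance Definition _ := Lmodule_isNormed.Build R[i] (wspace D)
  wnormD wnormZ wnorm0_eq0.

Lemma wnormE w : `|w| = (wnorm w)%:C. Proof. by []. Qed.

(** A Cauchy filter contains balls of radius [1 / (n + 1)] about some [u n]. The values of [u n]
    converge at each index, and [nd_closed] turns the limit function into an element. *)
Let wspace_complete (F : set_system (wspace D)) :
  ProperFilter F -> cauchy F -> cvg F.
Proof.
move=> FF /cauchyP cF.
have /choice[u hu] (n : nat) : exists w : wspace D, F (ball w (n.+1%:R^-1)%:C).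
  by apply: cF; rewrite ltcR invr_gt0.
have lt_ball w1 w2 (e : R) : ball w1 e%:C w2 -> wnorm (w1 - w2) < e.
  by rewrite -ball_normE /ball_ /= wnormE ltcR.
have cu n m : wnorm (u n - u m) <= n.+1%:R^-1 + m.+1%:R^-1.
  have [w [/lt_ball wn /lt_ball wm]] := filter_ex (filterI (hu n) (hu m)).
  rewrite -lecR -wnormE -(subrKA w) rmorphD.
  apply: (le_trans (ler_normD _ _)); rewrite [`|w - _|]distrC !wnormE lerD// lecR ltW//.
have /choice[g hg] x : exists c, forall n, normc (c - nd_ev (u n) x)
    <= 2 * (n.+1%:R^-1 * nd_rho x).
  apply: approx_limit => n m; rewrite -evB -mulrDl.
  by apply: (le_trans (wnormP _ _)); rewrite ler_wpM2r ?nd_rho_ge0.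
have [w hw] : exists w : wspace D, nd_ev w = g.
  apply: nd_closed => e e0.
  have [n] : exists n : nat, 2 / e < n%:R.
    by exists (Num.trunc (2 / e)).+1; rewrite truncnS_gt.
  move=> ne; exists (u n) => x; apply: (le_trans (hg x n)).
  rewrite mulrA ler_wpM2r ?nd_rho_ge0// ler_pdivrMr//.
  move: ne; rewrite ltr_pdivrMr// => /ltW/le_trans; apply.
  by rewrite mulrC ler_wpM2l ?ler_nat// ltW.
apply/cvg_ex; exists w; apply/cvg_ballP => _/posnumP[e].
have : 0 < e%:num by [].
move: (e%:num) => [r s] /=; rewrite ltcE /= => /andP[/eqP -> r0].
(* The [3] is the factor [2] of [approx_limit] plus [1] for the distance from [u n] to a point of
   its ball. *)
have [n] : exists n : nat, 3 / r < n.+1%:R.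
  by exists (Num.trunc (3 / r)); rewrite truncnS_gt.
rewrite ltr_pdivrMr// => ne; rewrite nearE; apply: filterS (hu n) => v /lt_ball uv.
rewrite -ball_normE /ball_ /= -(subrKA (u n)).
apply: (le_lt_trans (ler_normD _ _)).
have wu : wnorm (w - u n) <= 2 * n.+1%:R^-1.
  by apply: wnorm_le => [|x]; rewrite ?mulr_ge0// evB hw -mulrA hg.
rewrite !wnormE -rmorphD -[r +i* 0]/(r%:C) ltcR.
apply: (le_lt_trans (lerD wu (ltW uv))).
rewrite (_ : _ + _ = 3 / n.+1%:R); last by ring.
by rewrite ltr_pdivrMr// mulrC.
Qed.

HB.instance Definition _ := Uniform_isComplete.Build (wspace D) wspace_complete.

End WeightedNorm.

(** * Completion of a pre-Hilbert space *)

(** The restriction [e <= 1] lets later estimates absorb terms in [e * e] into a multiple of [e]. *)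
Lemma normc_eps_eq (R : realType) (x y : R[i]) (K : R) :
  (forall e, 0 < e -> e <= 1 -> normc (x - y) <= K * e) -> x = y.
Proof.
move=> H; apply/eqP; rewrite -subr_eq0; apply/eqP/ComplexField.Normc.eq0_normc.
apply/eqP; rewrite eq_le normc_ge0 andbT; apply/ler_addgt0Pr => e e0; rewrite add0r.
pose k := 1 + `|K|; have k0 : 0 < k by rewrite ltr_pwDl.
have m0 : 0 < Num.min 1 (e / k) by rewrite lt_min ltr01 divr_gt0.
apply: (le_trans (H _ m0 _)); first by rewrite ge_min lexx.
have [K0|K0] := leP K 0; first by rewrite (le_trans _ (ltW e0))// mulr_le0_ge0// ltW.
apply: (@le_trans _ _ (K * (e / k))).
  by rewrite ler_wpM2l ?(ltW K0)// ge_min lexx orbT.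
rewrite mulrCA ler_piMr ?(ltW e0)// ler_pdivrMr// mul1r /k.
by rewrite (gtr0_norm K0) lerDr.
Qed.

Record preHilbert (R : realType) := PreHilbert {
  ph_sort :> lmodType R[i];
  ph_form : ph_sort -> ph_sort -> R[i];
  ph_linear : forall k x y z,
    ph_form (k *: x + y) z = k * ph_form x z + ph_form y z;
  ph_herm : forall x y, ph_form x y = Num.conj (ph_form y x);
  ph_ge0 : forall x, 0 <= ph_form x x
}.

Section PreHilbertTheory.
Context {R : realType} (V : preHilbert R).
Local Notation B := (@ph_form R V).
Implicit Types x y z v w : V.

Lemma ph_formDl x y z : B (x + y) z = B x z + B y z.
Proof. by have := ph_linear 1 x y z; rewrite scale1r mul1r. Qed.

Lemma ph_form0l z : B 0 z = 0.
Proof. by apply: (addrI (B 0 z)); rewrite -ph_formDl !addr0. Qed.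

Lemma ph_formZl k x z : B (k *: x) z = k * B x z.
Proof. by have := ph_linear k x 0 z; rewrite addr0 ph_form0l addr0. Qed.

Lemma ph_formBl x y z : B (x - y) z = B x z - B y z.
Proof. by rewrite ph_formDl -scaleN1r ph_formZl mulN1r. Qed.

Lemma ph_formDr x y z : B z (x + y) = B z x + B z y.
Proof. by rewrite ph_herm ph_formDl rmorphD /= -!ph_herm. Qed.

Lemma ph_formZr k x z : B z (k *: x) = k^* * B z x.
Proof. by rewrite ph_herm ph_formZl rmorphM /= -ph_herm. Qed.

Lemma ph_formBr x y z : B z (x - y) = B z x - B z y.
Proof. by rewrite ph_herm ph_formBl rmorphB /= -!ph_herm. Qed.

Definition snorm x : R := Num.sqrt (complex.Re (B x x)).

Lemma snorm_ge0 x : 0 <= snorm x. Proof. exact: sqrtr_ge0. Qed.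

Lemma snorm_sqr x : snorm x ^+ 2 = complex.Re (B x x).
Proof. by rewrite sqr_sqrtr//; case: (ge0_Re (ph_ge0 x)). Qed.

Lemma snormE x : B x x = (snorm x ^+ 2)%:C.
Proof. by rewrite snorm_sqr; case: (ge0_Re (ph_ge0 x)) => ->. Qed.

Lemma ph_CauchySchwarz x y : normc (B x y) <= snorm x * snorm y.
Proof.
(* Positivity of the form at [x - t B(x, y) y], for real [t]. *)
have H (t : R) : 0 <= snorm x ^+ 2 - 2 * t * normc (B x y) ^+ 2
                      + t ^+ 2 * normc (B x y) ^+ 2 * snorm y ^+ 2.
  have := ph_ge0 (x - (t%:C * B x y) *: y).
  rewrite ph_formBl !ph_formBr ph_formZl !ph_formZr ph_formZl [B y x]ph_herm !snormE.
  have -> : (t%:C * B x y)^* = t%:C * (B x y)^* by rewrite rmorphM /= conj_realC.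
  have -> : t%:C * (B x y)^* * B x y = (t * normc (B x y) ^+ 2)%:C.
    by rewrite -mulrA [_^* * _]mulrC -normCK normcE -rmorphXn -rmorphM.
  have -> : t%:C * B x y * (B x y)^* = (t * normc (B x y) ^+ 2)%:C.
    by rewrite -mulrA -normCK normcE -rmorphXn -rmorphM.
  have -> : t%:C * (B x y)^* * (t%:C * B x y * (snorm y ^+ 2)%:C)
      = (t ^+ 2 * normc (B x y) ^+ 2 * snorm y ^+ 2)%:C.
    rewrite mulrA mulrACA [_^* * _]mulrC -normCK normcE -rmorphXn -!rmorphM.
    by rewrite -expr2.
  rewrite -!rmorphB ler0c.
  by move=> /le_trans; apply; rewrite le_eqVlt; apply/orP; left; apply/eqP; ring.
have [b0|b0] := eqVneq (normc (B x y)) 0.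
  by rewrite b0 mulr_ge0 ?snorm_ge0.
have bb : 0 < normc (B x y) ^+ 2 by rewrite exprn_even_gt0.
rewrite -(@ler_pXn2r _ 2)// ?nnegrE ?mulr_ge0 ?snorm_ge0 ?normc_ge0// exprMn.
have [c0|c0] := eqVneq (snorm y ^+ 2) 0.
  (* When [y] has seminorm zero, the expression is affine in [t], and this [t] makes it equal to
     [-1]. *)
  have := H ((snorm x ^+ 2 + 1) / (2 * normc (B x y) ^+ 2)).
  rewrite c0 mulr0 addr0 (_ : 2 * _ * _ = snorm x ^+ 2 + 1); first by lra.
  by field; rewrite b0.
have cc : 0 < snorm y ^+ 2 by rewrite lt_def c0 sqr_ge0.
have := H (snorm y ^+ 2)^-1.
rewrite (_ : _ - _ + _ = snorm x ^+ 2 - normc (B x y) ^+ 2 / snorm y ^+ 2); last first.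
  by field; apply: contraNneq c0 => ->; rewrite expr0n.
by rewrite subr_ge0 ler_pdivrMr.
Qed.

(** The hypothesis is tested at [v] itself; this reduces bounds on the seminorm to bounds on the
    form. *)
Lemma snorm_le v (e : R) : 0 <= e ->
  (forall y, normc (B v y) <= e * snorm y) -> snorm v <= e.
Proof.
move=> e0 /(_ v); rewrite snormE normc_real ger0_norm ?sqr_ge0// expr2.
have := snorm_ge0 v; rewrite le_eqVlt => /orP[/eqP <-//|s0].
by rewrite ler_pM2r.
Qed.

Lemma snormD x y : snorm (x + y) <= snorm x + snorm y.
Proof.
apply: snorm_le => [|z]; first by rewrite addr_ge0 ?snorm_ge0.
rewrite ph_formDl mulrDl; apply: (le_trans (normcD _ _)).
by apply: lerD; exact: ph_CauchySchwarz.
Qed.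

Lemma snormZ k v : snorm (k *: v) = normc k * snorm v.
Proof.
apply/eqP; rewrite -(@eqrXn2 _ 2)// ?mulr_ge0 ?snorm_ge0 ?normc_ge0//; apply/eqP.
apply: complexI; rewrite -snormE ph_formZl ph_formZr snormE mulrA -normCK.
by rewrite normcE exprMn [RHS]rmorphM /= !rmorphXn.
Qed.

Lemma snorm_eq0_of_le v :
  (forall e : R, 0 < e -> snorm v <= e) -> snorm v = 0.
Proof.
move=> h; apply/eqP; rewrite eq_le snorm_ge0 andbT.
by apply/ler_addgt0Pr => e e0; rewrite add0r h.
Qed.

Lemma snormB_sqr x y :
  snorm (x - y) ^+ 2 = snorm x ^+ 2 - 2 * complex.Re (ph_form x y) + snorm y ^+ 2.
Proof.
rewrite !snorm_sqr ph_formBl !ph_formBr [ph_form y x]ph_herm.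
case: (ph_form x x) (ph_form x y) (ph_form y y) => ? ? [? ?] [? ?] /=.
by ring.
Qed.

(* The completion of [V] is realised inside its conjugate dual: it consists of
   the functionals that are uniform limits of the functionals [B v]. *)
Definition approximable : {pred V -> R[i]^o} := fun F =>
  `[< forall e : R, 0 < e -> exists v, forall y, normc (F y - B v y) <= e * snorm y >].

Lemma approximable_submod : submod_closed approximable.
Proof.
split.
  apply/asboolP => e e0; exists 0 => y.
  by rewrite ph_form0l subr0 ComplexField.Normc.normc0 mulr_ge0 ?snorm_ge0// ltW.
move=> k F G /asboolP hF /asboolP hG; apply/asboolP => e e0.
pose d := e / 2 / (1 + normc k).
have k0 : 0 < 1 + normc k by rewrite ltr_pwDl ?normc_ge0.
have [v hv] := hF d (divr_gt0 (divr_gt0 e0 (ltr0Sn _ _)) k0).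
have [w hw] := hG (e / 2) (divr_gt0 e0 (ltr0Sn _ _)).
exists (k *: v + w) => y; rewrite ph_linear.
rewrite [X in normc X](_ : _ = k * (F y - B v y) + (G y - B w y)); last first.
  rewrite [(k *: F + G) y](_ : _ = k * F y + G y)//; ring.
apply: (le_trans (normcD _ _)); rewrite ComplexField.Normc.normcM.
have -> : e * snorm y = e / 2 * snorm y + e / 2 * snorm y by field.
apply: lerD => //; apply: (le_trans (ler_wpM2l (normc_ge0 _) (hv y))).
rewrite mulrA ler_wpM2r ?snorm_ge0// /d mulrCA ler_piMr ?divr_ge0 ?(ltW e0)//.
by rewrite ler_pdivrMr// mul1r lerDr.
Qed.

HB.instance Definition _ :=
  GRing.isSubmodClosed.Build _ _ approximable approximable_submod.

Record cfun := CFun { cfun_val :> V -> R[i]^o; _ : cfun_val \in approximable }.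

HB.instance Definition _ := [isSub for cfun_val].
HB.instance Definition _ := [Choice of cfun by <:].
HB.instance Definition _ := [SubChoice_isSubLmodule of cfun by <:].

Lemma cfunP (F : cfun) (e : R) : 0 < e ->
  exists v, forall y, normc (F y - B v y) <= e * snorm y.
Proof. by case: F => F /= /asboolP; apply. Qed.

(** With the seminorm as weight, the weighted supremum norm is the norm of functionals. *)
Program Definition completion_data : normData R :=
  @NormData R cfun V (fun F y => F y) snorm _ _ _ _ _.
Next Obligation. by []. Qed.
Next Obligation. exact: snorm_ge0. Qed.
Next Obligation.
move=> F; have [v hv] := cfunP F ltr01.
exists (1 + snorm v); split; first by rewrite addr_ge0 ?snorm_ge0.
move=> y; rewrite -[F y](subrK (B v y)) mulrDl.
by apply: (le_trans (normcD _ _)); apply: lerD => //; exact: ph_CauchySchwarz.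
Qed.
Next Obligation. by move=> F F0; apply/val_inj/funext => y; exact: F0. Qed.
Next Obligation.
move=> g hg; suff gP : g \in approximable by exists (CFun gP).
apply/asboolP => e e0; have e2 : 0 < e / 2 by rewrite divr_gt0.
have [F hF] := hg _ e2; have [v hv] := cfunP F e2.
exists v => y; rewrite [e]splitr mulrDl.
by apply: (le_trans (normc_triangle _ (F y) _)); apply: lerD.
Qed.

Definition completion : completeNormedModType R[i] := wspace completion_data.

Implicit Types F G : completion.

Definition cval F : V -> R[i] := nd_ev F.

Lemma cval_lin k F G y : cval (k *: F + G) y = k * cval F y + cval G y.
Proof. by []. Qed.

Lemma cval_inj F G : (forall y, cval F y = cval G y) -> F = G.
Proof. by move=> FG; apply/val_inj/funext. Qed.

Lemma cval_le F y : normc (cval F y) <= wnorm F * snorm y.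
Proof. exact: (@wnormP _ completion_data). Qed.

Lemma cval_approx F (e : R) : 0 < e ->
  exists v, forall y, normc (cval F y - B v y) <= e * snorm y.
Proof. exact: cfunP. Qed.

Lemma approximable_form v : (B v : V -> R[i]^o) \in approximable.
Proof.
apply/asboolP => e e0; exists v => y.
by rewrite subrr ComplexField.Normc.normc0 mulr_ge0 ?snorm_ge0// ltW.
Qed.

Definition cincl v : completion := CFun (approximable_form v).

Lemma cval_incl v y : cval (cincl v) y = B v y. Proof. by []. Qed.

Lemma cincl_lin k v w : cincl (k *: v + w) = k *: cincl v + cincl w.
Proof. by apply: cval_inj => y; rewrite cval_lin !cval_incl ph_linear. Qed.

(** The functionals [B u] are conjugate linear, and this passes to their uniform limits. *)
Lemma cval_anti k F v w : cval F (k *: v + w) = k^* * cval F v + cval F w.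
Proof.
apply: (@normc_eps_eq _ _ _ (snorm (k *: v + w) + normc k * snorm v + snorm w)).
move=> e e0 _; have [u hu] := cval_approx F e0.
have -> : cval F (k *: v + w) - (k^* * cval F v + cval F w) =
    (cval F (k *: v + w) - B u (k *: v + w)) +
    (- (k^* * (cval F v - B u v)) + - (cval F w - B u w)).
  by rewrite ph_formDr ph_formZr; ring.
apply: (le_trans (normcD _ _)); rewrite -addrA mulrDl; apply: lerD.
  by rewrite mulrC hu.
apply: (le_trans (normcD _ _)); rewrite !normcN ComplexField.Normc.normcM normc_conj.
rewrite mulrDl -mulrA; apply: lerD; last by rewrite mulrC hu.
by rewrite ler_wpM2l ?normc_ge0// mulrC hu.
Qed.

End PreHilbertTheory.

(** * The inner product of the completion and the extension of operators *)

Section CompletionInner.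
Context {R : realType} (V : preHilbert R).
Local Notation B := (@ph_form R V).
Local Notation H := (completion V).
Implicit Types (F G : H) (v w y : V).

Let close G w (e : R) := forall y, normc (cval G y - B w y) <= e * snorm y.

Let close_snorm G w (e : R) : 0 <= e -> close G w e -> snorm w <= wnorm G + e.
Proof.
move=> e0 c; apply: snorm_le => [|y]; first by rewrite addr_ge0 ?wnorm_ge0.
rewrite -[B w y](subrK (cval G y)) addrC mulrDl.
apply: (le_trans (normcD _ _)); apply: lerD; first exact: cval_le.
by rewrite normcB.
Qed.

Let close_wnorm G w (e : R) : 0 <= e -> close G w e -> wnorm G <= snorm w + e.
Proof.
move=> e0 c; apply: wnorm_le => [|y]; first by rewrite addr_ge0 ?snorm_ge0.
rewrite -[nd_ev G y](subrK (B w y)) addrC mulrDl.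
apply: (le_trans (normcD _ _)); apply: lerD; [exact: ph_CauchySchwarz | exact: c].
Qed.

Let cvalBr F v w : cval F (v - w) = cval F v - cval F w.
Proof. by have := cval_anti (-1) F w v; rewrite scaleN1r rmorphN1 mulN1r ![- _ + _]addrC. Qed.

(** The inner product of [F] and [G] is the limit of [cval F w] as [w] approaches [G]. Comparing [w]
    with [u n] for large [n] removes the factor [2] of [approx_limit], which leaves an error bound
    valid for every [w]. *)
Let inner_ex F G : exists c, forall w (e : R), 0 <= e -> close G w e ->
  normc (c - cval F w) <= wnorm F * e.
Proof.
have /choice[u hu] (n : nat) : exists w, close G w n.+1%:R^-1.
  by apply: cval_approx; rewrite invr_gt0.
have close2 v w (d e : R) : 0 <= d -> 0 <= e -> close G v d -> close G w e ->
    normc (cval F v - cval F w) <= wnorm F * d + wnorm F * e.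
  move=> d0 e0 hv hw; rewrite -cvalBr -mulrDr; apply: (le_trans (cval_le _ _)).
  rewrite ler_wpM2l ?wnorm_ge0//; apply: snorm_le => [|y]; first by rewrite addr_ge0.
  rewrite ph_formBl mulrDl; apply: (le_trans (normc_triangle _ (cval G y) _)).
  by rewrite lerD// normcB.
have [c hc] : exists c, forall n, normc (c - cval F (u n))
    <= 2 * (wnorm F * n.+1%:R^-1).
  by apply: approx_limit => n m; apply: close2; rewrite ?invr_ge0.
exists c => w e e0 hw; apply/ler_addgt0Pr => d d0.
have [n] : exists n : nat, 3 * wnorm F / d < n.+1%:R.
  by exists (Num.trunc (3 * wnorm F / d)); rewrite truncnS_gt.
rewrite ltr_pdivrMr// => /ltW nd.
apply: (le_trans (normc_triangle _ (cval F (u n)) _)).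
have := close2 _ _ _ _ _ e0 (hu n) hw; rewrite invr_ge0 => /(_ (ler0n _ _)).
have := hc n.
have : 3 * (wnorm F * n.+1%:R^-1) <= d.
  by rewrite mulrA ler_pdivrMr// [d * _]mulrC.
by move: (normc _) (normc _) (wnorm F * _) (wnorm F * e) => a b p q; lra.
Qed.

Definition cinner F G : R[i] := projT1 (cid (inner_ex F G)).

Let cinnerP F G w (e : R) : 0 <= e -> close G w e ->
  normc (cinner F G - cval F w) <= wnorm F * e.
Proof. by rewrite /cinner; case: cid => c /= h; exact: h. Qed.

Lemma cinner_incl F w : cinner F (cincl w) = cval F w.
Proof.
apply/eqP; rewrite -subr_eq0; apply/eqP/ComplexField.Normc.eq0_normc/eqP.
rewrite eq_le normc_ge0 andbT -(mulr0 (wnorm F)); apply: cinnerP => // y.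
by rewrite cval_incl subrr mul0r ComplexField.Normc.normc0.
Qed.

Let cinner_lin k F1 F2 G :
  cinner (k *: F1 + F2) G = k * cinner F1 G + cinner F2 G.
Proof.
apply: (@normc_eps_eq _ _ _ (wnorm (k *: F1 + F2) + normc k * wnorm F1 + wnorm F2)).
move=> e e0 _; have [w hw] := cval_approx G e0.
have h F := @cinnerP F G w e (ltW e0) hw.
have -> : cinner (k *: F1 + F2) G - (k * cinner F1 G + cinner F2 G) =
    (cinner (k *: F1 + F2) G - cval (k *: F1 + F2) w) +
    (- (k * (cinner F1 G - cval F1 w)) + - (cinner F2 G - cval F2 w)).
  by rewrite cval_lin; ring.
apply: (le_trans (normcD _ _)); rewrite -addrA mulrDl; apply: lerD => //.
apply: (le_trans (normcD _ _)); rewrite !normcN ComplexField.Normc.normcM.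
by rewrite mulrDl -mulrA; apply: lerD => //; rewrite ler_wpM2l ?normc_ge0.
Qed.

Let cinner_herm F G : cinner F G = (-1) ^+ false * (cinner G F)^*.
Proof.
rewrite expr0 mul1r.
apply: (@normc_eps_eq _ _ _ (2 * (wnorm F + wnorm G + 1))) => e e0 e1.
have [v hv] := cval_approx F e0; have [w hw] := cval_approx G e0.
have e0' := ltW e0.
have -> : cinner F G - (cinner G F)^* = (cinner F G - cval F w)
   + ((cval F w - B v w) + - ((cinner G F - cval G v) + (cval G v - B w v))^*).
  by rewrite [B v w]ph_herm subrKA rmorphB; ring.
have f1 := @cinnerP F G w e e0' hw; have f2 := @cinnerP G F v e e0' hv.
have f3 := le_trans (hv w) (ler_wpM2l e0' (close_snorm e0' hw)).
have f4 := le_trans (hw v) (ler_wpM2l e0' (close_snorm e0' hv)).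
have f5 : e * e <= e by rewrite ler_piMr.
apply: (le_trans (normcD _ _)); apply: (le_trans (lerD f1 (normcD _ _))).
rewrite normcN normc_conj.
have f6 := le_trans (normcD _ _) (lerD f2 f4).
apply: (le_trans (lerD (lexx _) (lerD f3 f6))).
move: f5; rewrite !mulrDr; move: (wnorm F) (wnorm G) => a b; nra.
Qed.

(** Both sides differ from [B v v] by a multiple of [e], where [v] approximates [F] up to [e]. *)
Lemma cinner_norm F : cinner F F = (wnorm F ^+ 2)%:C.
Proof.
apply: (@normc_eps_eq _ _ _ (4 * wnorm F + 2)) => e e0 e1.
have e0' := ltW e0; have [v hv] := cval_approx F e0.
have f1 := @cinnerP F F v e e0' hv; have f2 := hv v.
have f3 := close_snorm e0' hv; have f4 := close_wnorm e0' hv.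
have s0 := snorm_ge0 v; have w0 := wnorm_ge0 F.
have f5 : normc (B v v - (wnorm F ^+ 2)%:C) <= e * (2 * wnorm F + e).
  rewrite snormE -rmorphB normc_real; move: f3 f4 s0 w0.
  move: (snorm v) (wnorm F) => a b h1 h2 h3 h4.
  rewrite (_ : a ^+ 2 - b ^+ 2 = (a - b) * (a + b)); last by ring.
  rewrite normrM; apply: ler_pM => //; first by rewrite ler_norml; apply/andP; split; lra.
  by rewrite ger0_norm; lra.
apply: (le_trans (normc_triangle _ (cval F v) _)).
apply: (le_trans (lerD f1 (normc_triangle _ (B v v) _))).
apply: (le_trans (lerD (lexx _) (lerD f2 f5))).
have f7 : e * snorm v <= e * (wnorm F + e) by rewrite ler_wpM2l.
have f6 : e * e <= e by rewrite ler_piMr.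
by move: f6 f7; rewrite !mulrDr; move: (wnorm F) (snorm v) => a b; nra.
Qed.

Let cinner_bilinear : bilinear_for
  (GRing.Scale.Law.clone _ _ *%R _) (GRing.Scale.Law.clone _ _ (Num.conj \; *%R) _)
  (cinner : H -> H -> R[i]).
Proof.
split=> [G k F1 F2 | F k G1 G2] /=; first exact: cinner_lin.
rewrite cinner_herm cinner_lin rmorphD rmorphM /= expr0 mul1r.
by rewrite [cinner F G1]cinner_herm [cinner F G2]cinner_herm !mul1r.
Qed.

HB.instance Definition _ := bilinear_isBilinear.Build R[i] H H R[i]
  (GRing.Scale.Law.clone _ _ *%R _) (GRing.Scale.Law.clone _ _ (Num.conj \; *%R) _)
  cinner cinner_bilinear.

HB.instance Definition _ :=
  isHermitianSesquilinear.Build R[i] H false Num.conj cinner cinner_herm.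

Let cinner_gt0 F : F != 0 -> 0 < cinner F F.
Proof.
move=> F0; rewrite cinner_norm ltcR exprn_gt0// lt_def wnorm_ge0 andbT.
apply: contra F0 => /eqP F0; rewrite -normr_eq0.
by rewrite wnormE F0.
Qed.

HB.instance Definition _ := isDotProduct.Build R[i] H cinner cinner_gt0.

Definition cinner_dot : {dot H for (@Num.conj R[i])} := cinner.

Let cinner_normE F : `|F| ^+ 2 = cinner_dot F F.
Proof. by rewrite /cinner_dot /= cinner_norm wnormE rmorphXn. Qed.

Definition completion_hilbert : hilbertSpace R := HilbertSpace cinner_normE.

Lemma cincl_dense F (e : R) : 0 < e -> exists v, wnorm (F - cincl v) <= e.
Proof.
move=> e0; have [v hv] := cval_approx F e0; exists v.
by apply: wnorm_le; [exact: ltW | exact: hv].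
Qed.

(* On the conjugate dual, the extension of [T] is precomposition with its formal
   adjoint [T']. *)
Section Lift.
Context (T T' : V -> V) (M : R).
Hypothesis TT' : forall x y, B (T x) y = B x (T' y).
Hypothesis M0 : 0 <= M.
Hypothesis T'M : forall y, snorm (T' y) <= M * snorm y.

Let lift_approximable F : (fun y => cval F (T' y) : R[i]^o) \in @approximable R V.
Proof.
(* Dividing by [M + 1] rather than [M] allows [M = 0]. *)
apply/asboolP => e e0; have m0 : 0 < M + 1 by rewrite ltr_wpDl.
have [v hv] := cval_approx F (divr_gt0 e0 m0).
exists (T v) => y; rewrite TT'; apply: (le_trans (hv _)).
apply: (le_trans (ler_wpM2l _ (T'M _))); first by rewrite divr_ge0// ltW.
rewrite mulrA ler_wpM2r ?snorm_ge0// mulrAC ler_pdivrMr// ler_wpM2l ?(ltW e0)//.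
by rewrite lerDl.
Qed.

Definition clift F : H := CFun (lift_approximable F).

Lemma clift_le F : wnorm (clift F) <= M * wnorm F.
Proof.
apply: wnorm_le => [|y]; first by rewrite mulr_ge0 ?wnorm_ge0.
apply: (le_trans (cval_le F (T' y))).
by rewrite [M * _]mulrC -mulrA ler_wpM2l ?wnorm_ge0//; exact: T'M.
Qed.

End Lift.

End CompletionInner.

(** * States and the universal representation *)

Section RealNorm.
Context {R : realType} {W : normedModType R[i]}.
Implicit Types x y : W.

Lemma rnormE x : `|x| = (rnorm x)%:C.
Proof. by rewrite /rnorm; case: (ge0_Re (normr_ge0 x)). Qed.

Lemma rnorm_ge0 x : 0 <= rnorm x.
Proof. by rewrite -ler0c -rnormE normr_ge0. Qed.

Lemma rnorm0 : rnorm (0 : W) = 0.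
Proof. by apply: complexI; rewrite -rnormE normr0. Qed.

Lemma rnorm0_eq0 x : rnorm x = 0 -> x = 0.
Proof. by move=> x0; apply/eqP; rewrite -normr_eq0 rnormE x0. Qed.

Lemma rnormD x y : rnorm (x + y) <= rnorm x + rnorm y.
Proof. by rewrite -lecR rmorphD /= -!rnormE ler_normD. Qed.

Lemma rnormB x y : rnorm (x - y) = rnorm (y - x).
Proof. by apply: complexI; rewrite -!rnormE distrC. Qed.

Lemma rnormZ k x : rnorm (k *: x) = normc k * rnorm x.
Proof. by apply: complexI; rewrite rmorphM /= -!rnormE normrZ. Qed.

Lemma rnorm_closure (S : set W) x (e : R) :
  closure S x -> 0 < e -> exists2 y, S y & rnorm (x - y) < e.
Proof.
move=> cl e0; have [|y [Sy xy]] := cl (ball x e%:C); first by apply: nbhsx_ballx; rewrite ltcR.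
by exists y => //; move: xy; rewrite -ball_normE /ball_ /= rnormE ltcR.
Qed.

Lemma closure_rnorm (S : set W) x :
  (forall e : R, 0 < e -> exists2 y, S y & rnorm (x - y) < e) -> closure S x.
Proof.
move=> H B /nbhs_ballP[r] /=; case: r => r s; rewrite ltcE /= => /andP[/eqP -> r0] rB.
have [y Sy xy] := H r r0; exists y; split => //; apply: rB.
by rewrite -ball_normE /ball_ /= rnormE -[r +i* 0]/(r%:C) ltcR.
Qed.

End RealNorm.

Section OperatorNorm.
Context {R : realType} {V W : normedModType R[i]}.

Lemma opnorm_ge (f : V -> W) x : rnorm x <= 1 -> ((rnorm (f x))%:E <= opnorm f)%E.
Proof.
move=> x1; apply: ereal_sup_ubound; exists x => //=.
by rewrite rnormE -(rmorph1 (real_complex R)) lecR.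
Qed.

Lemma opnorm_le (f : V -> W) (d : R) : 0 <= d ->
  (forall x, rnorm (f x) <= d * rnorm x) -> (opnorm f <= d%:E)%E.
Proof.
move=> d0 h; apply: ge_ereal_sup => _ [x /= x1 <-]; rewrite lee_fin.
by apply: (le_trans (h x)); rewrite ler_piMr// -lecR -rnormE.
Qed.

End OperatorNorm.

Lemma rnorm_complex (R : realType) (z : R[i]) : rnorm (z : R[i]^o) = normc z.
Proof. by []. Qed.

Section HilbertTheory.
Context {R : realType} (H : hilbertSpace R).
Local Notation inner := (hs_inner H).
Implicit Types x y z : H.

Lemma inner_linear k x y z : inner (k *: x + y) z = k * inner x z + inner y z.
Proof. exact: linearPl. Qed.

Lemma inner_herm x y : inner x y = Num.conj (inner y x).
Proof. by rewrite hermC expr0 mul1r. Qed.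

Lemma inner_ge0 x : 0 <= inner x x.
Proof. by rewrite -hs_normE exprn_ge0. Qed.

Definition hs_pre : preHilbert R := PreHilbert inner_linear inner_herm inner_ge0.

Lemma inner_sqr x : inner x x = (rnorm x ^+ 2)%:C.
Proof. by rewrite -hs_normE rnormE rmorphXn. Qed.

Lemma snorm_hs x : snorm (x : hs_pre) = rnorm x.
Proof. by rewrite /snorm /= inner_sqr /= sqrtr_sqr ger0_norm ?rnorm_ge0. Qed.

Lemma inner_CS x y : normc (inner x y) <= rnorm x * rnorm y.
Proof. by have := @ph_CauchySchwarz R hs_pre x y; rewrite !snorm_hs. Qed.

Lemma innerDl x y z : inner (x + y) z = inner x z + inner y z.
Proof. exact: (@ph_formDl R hs_pre). Qed.
Lemma innerBl x y z : inner (x - y) z = inner x z - inner y z.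
Proof. exact: (@ph_formBl R hs_pre). Qed.
Lemma innerDr x y z : inner z (x + y) = inner z x + inner z y.
Proof. exact: (@ph_formDr R hs_pre). Qed.
Lemma innerBr x y z : inner z (x - y) = inner z x - inner z y.
Proof. exact: (@ph_formBr R hs_pre). Qed.
Lemma inner0l z : inner 0 z = 0.
Proof. exact: (@ph_form0l R hs_pre). Qed.

Lemma closure_orthogonal (S : set H) x y :
  closure S x -> (forall s, S s -> inner s y = 0) -> inner x y = 0.
Proof.
move=> cl S0; apply: (@normc_eps_eq _ _ _ (rnorm y)) => e e0 _.
have [s Ss xs] := rnorm_closure cl e0.
rewrite -(S0 s Ss) -innerBl; apply: (le_trans (inner_CS _ _)).
by rewrite mulrC ler_wpM2l ?rnorm_ge0// ltW.
Qed.

End HilbertTheory.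

(** * Elementary facts on C*-algebras *)

Section CStarTheory.
Context {R : realType} {A : cstarAlgebra R}.
Implicit Types a b c : A.
Local Notation "a ** b" := (cs_mul a b) (at level 40, left associativity).
Local Notation star := (@cs_star R A).

Lemma cs_mulZl k a b c : cs_mul (k *: a + b) c = k *: (a ** c) + b ** c.
Proof. by rewrite cs_mulDl cs_scaleAl. Qed.

Lemma cs_mul0r a : a ** 0 = 0.
Proof. by apply: (addrI (a ** 0)); rewrite -cs_mulDr !addr0. Qed.

Lemma cs_mul0l a : cs_mul 0 a = 0.
Proof. by apply: (addrI (cs_mul 0 a)); rewrite -cs_mulDl !addr0. Qed.

Lemma cs_mulBr a b c : a ** (b - c) = a ** b - a ** c.
Proof. by rewrite cs_mulDr -[- c]scaleN1r cs_scaleAr scaleN1r. Qed.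

Lemma cs_mulBl a b c : (b - c) ** a = b ** a - c ** a.
Proof. by rewrite cs_mulDl -[- c]scaleN1r cs_scaleAl scaleN1r. Qed.

Lemma cs_star0 : star 0 = 0.
Proof. by apply: (addrI (star 0)); rewrite -cs_starD !addr0. Qed.

Lemma cs_starB a b : star (a - b) = star a - star b.
Proof. by rewrite cs_starD -[- b]scaleN1r cs_starZ rmorphN1 scaleN1r. Qed.

Lemma cs_rnormM a b : rnorm (a ** b) <= rnorm a * rnorm b.
Proof. by rewrite -lecR rmorphM /= -!rnormE cs_normM. Qed.

Lemma cs_rnorm_star_mul a : rnorm (star a ** a) = rnorm a ^+ 2.
Proof. by apply: complexI; rewrite rmorphXn /= -!rnormE cs_norm_star. Qed.

(** By the C*-identity and submultiplicativity, the square of the norm of [b] is at most the product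
    of the norms of [star b] and [b]; then divide. *)
Lemma cs_rnorm_star a : rnorm (star a) = rnorm a.
Proof.
have le_star b : rnorm b <= rnorm (star b).
  have [->|b0] := eqVneq (rnorm b) 0; first exact: rnorm_ge0.
  have b1 : 0 < rnorm b by rewrite lt_def b0 rnorm_ge0.
  by rewrite -(ler_pM2r b1) -expr2 -cs_rnorm_star_mul cs_rnormM.
by apply/eqP; rewrite eq_le le_star -{2}[a]cs_starK le_star.
Qed.

Definition is_unit (u : A) := forall a, u ** a = a /\ a ** u = a.

Lemma is_unit_star u : is_unit u -> star u = u.
Proof.
move=> hu; have h : star u ** u = star u by case: (hu (star u)).
by rewrite -[RHS]cs_starK -h cs_starM cs_starK h.
Qed.

End CStarTheory.

(** If [y] exceeded [N > 0], the powers of [y / N] would be unbounded by Bernoulli's inequality,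
    whereas the hypothesis bounds them by [C]. *)
Lemma le_of_pow_bound (R : realType) (y N C : R) : 0 <= y -> 0 <= N ->
  (forall n, y ^+ (2 ^ n) <= C * N ^+ (2 ^ n)) -> y <= N.
Proof.
move=> y0 N0 H; rewrite leNgt; apply/negP => Ny.
have [N1|N1] := eqVneq N 0.
  by have := H 0%N; rewrite N1 !expr1 mulr0 leNgt -N1 Ny.
have Np : 0 < N by rewrite lt_def N1.
pose d := y / N - 1.
have d0 : 0 < d by rewrite subr_gt0 ltr_pdivlMr// mul1r.
have bern m : 1 + m%:R * d <= (y / N) ^+ m.
  elim: m => [|m IH]; first by rewrite mul0r addr0.
  have yN : y / N = 1 + d by rewrite /d addrCA subrr addr0.
  rewrite exprS; apply: (@le_trans _ _ (y / N * (1 + m%:R * d))); last first.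
    by rewrite ler_wpM2l ?divr_ge0.
  rewrite yN -natr1; have : 0 <= m%:R * d ^+ 2 by rewrite mulr_ge0 ?sqr_ge0.
  by lra.
have {}H n : n%:R * d <= C.
  apply: (@le_trans _ _ (1 + (2 ^ n)%N%:R * d)).
    rewrite ler_wpDl// ler_wpM2r ?(ltW d0)// ler_nat.
    exact/ltnW/ltn_expl.
  by apply: (le_trans (bern _)); rewrite expr_div_n ler_pdivrMr ?exprn_gt0.
have := H (Num.trunc (C / d)).+1.
by rewrite -ler_pdivlMr// leNgt truncnS_gt.
Qed.

Section States.
Context {R : realType} {A : cstarAlgebra R} (phi : A -> R[i]) (sphi : state phi).
Implicit Types a b c : A.
Local Notation "a ** b" := (cs_mul a b) (at level 40, left associativity).
Local Notation star := (@cs_star R A).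

Lemma state_lin k a b : phi (k *: a + b) = k * phi a + phi b.
Proof. by case: sphi => h _ _; exact: h. Qed.

Let state_add a b : phi (a + b) = phi a + phi b.
Proof. by have := state_lin 1 a b; rewrite scale1r mul1r. Qed.

Lemma state_0 : phi 0 = 0.
Proof. by apply: (addrI (phi 0)); rewrite -state_add !addr0. Qed.

Let state_scale k a : phi (k *: a) = k * phi a.
Proof. by have := state_lin k a 0; rewrite state_0 !addr0. Qed.

Lemma state_ge0 a : 0 <= phi (star a ** a).
Proof. by case: sphi. Qed.

Lemma state_le a : normc (phi a) <= rnorm a.
Proof.
have [a0|a0] := eqVneq (rnorm a) 0.
  by rewrite a0 (rnorm0_eq0 a0) state_0 ComplexField.Normc.normc0.
have a1 : 0 < rnorm a by rewrite lt_def a0 rnorm_ge0.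
case: sphi => _ _ on; pose b := (rnorm a)^-1%:C *: a.
have : ((rnorm (phi b : R[i]^o))%:E <= 1%E)%E.
  rewrite -on; apply: ereal_sup_ubound; exists b => //=.
  rewrite rnormE rnormZ normc_real ger0_norm ?invr_ge0 ?rnorm_ge0//.
  by rewrite mulVf.
rewrite lee_fin rnorm_complex /b state_scale ComplexField.Normc.normcM normc_real.
by rewrite ger0_norm ?invr_ge0 ?rnorm_ge0// mulrC ler_pdivrMr// mul1r.
Qed.

(** The GNS form, linear in its first argument. *)
Let form a b := phi (star b ** a).

Let form_linear k a b c : form (k *: a + b) c = k * form a c + form b c.
Proof. by rewrite /form cs_mulDr cs_scaleAr state_lin. Qed.

(* Hermitian symmetry follows by polarisation, as [phi (c^* c)] is real. *)
Let form_herm a b : form a b = Num.conj (form b a).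
Proof.
have real (c : A) : complex.Im (phi (star c ** c)) = 0 by exact: ger0_Im (state_ge0 c).
have h1 := real (a + b); have h2 := real ('i%C *: a + b).
move: h1 h2; rewrite !cs_starD !cs_starZ !cs_mulDl !cs_mulDr !cs_scaleAl !cs_scaleAr.
rewrite !state_add !state_scale /form.
have := real a; have := real b.
case: (phi (star a ** a)) (phi (star b ** b)) => a1 a2 [b1 b2] /= -> ->.
case: (phi (star a ** b)) (phi (star b ** a)) => x1 x2 [y1 y2] /=.
rewrite -[Num.conj _]/(conjc _) /= => h1 h2.
by apply/eqP; rewrite eq_complex /=; apply/andP; split; apply/eqP; lra.
Qed.

Definition state_pre : preHilbert R :=
  @PreHilbert R A form form_linear form_herm state_ge0.

Lemma state_preE (a b : state_pre) : ph_form a b = phi (star b ** a).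
Proof. by []. Qed.

(* With [h = a^* a] and [x n] the seminorm of [h^(2^n) b], Cauchy-Schwarz gives
   [x n ^ 2 <= s * x n.+1], which bounds [x 0 / s] by the growth rate of [x]. *)
Lemma state_mul_le a b :
  snorm (a ** b : state_pre) <= rnorm a * snorm (b : state_pre).
Proof.
pose h n := iter n (fun c => c ** c) (star a ** a).
have hS n : h n.+1 = h n ** h n by [].
have h_star n : star (h n) = h n.
  by elim: n => [|n IH]; rewrite ?hS cs_starM ?IH ?cs_starK.
have h_norm n : rnorm (h n) <= (rnorm a ^+ 2) ^+ (2 ^ n).
  elim: n => [|n IH]; first by rewrite /h /= cs_rnorm_star_mul.
  rewrite hS expnS mul2n -addnn exprD; apply: (le_trans (cs_rnormM _ _)).
  by rewrite ler_pM ?rnorm_ge0.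
pose x n := snorm (h n ** b : state_pre); pose s := snorm (b : state_pre).
have s0 : 0 <= s := snorm_ge0 _.
have xE n : x n ^+ 2 = complex.Re (phi (star b ** (h n.+1 ** b))).
  by rewrite /x snorm_sqr state_preE cs_starM h_star hS !cs_mulA.
have x_le n : x n ^+ 2 <= s * x n.+1.
  rewrite xE; apply: (le_trans (Re_le_normc _)); rewrite mulrC.
  exact: (@ph_CauchySchwarz _ state_pre).
have a_le : snorm (a ** b : state_pre) ^+ 2 <= s * x 0%N.
  rewrite snorm_sqr state_preE cs_starM -cs_mulA [X in cs_mul _ X]cs_mulA.
  by apply: (le_trans (Re_le_normc _)); rewrite mulrC; exact: (@ph_CauchySchwarz _ state_pre).
have x_ub n : x n <= (rnorm b + 1) * (rnorm a ^+ 2) ^+ (2 ^ n).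
  rewrite -(@ler_pXn2r _ 2)// ?nnegrE ?snorm_ge0 ?mulr_ge0 ?addr_ge0 ?exprn_ge0 ?rnorm_ge0//.
  rewrite xE; apply: (le_trans (Re_le_normc _)); apply: (le_trans (state_le _)).
  apply: (le_trans (cs_rnormM _ _)); rewrite cs_rnorm_star.
  apply: (le_trans (ler_wpM2l (rnorm_ge0 _) (cs_rnormM _ _))).
  rewrite mulrCA -expr2 mulrC exprMn; apply: ler_pM; rewrite ?sqr_ge0 ?rnorm_ge0//.
    by rewrite ler_pXn2r ?nnegrE ?addr_ge0 ?rnorm_ge0// lerDl.
  by apply: (le_trans (h_norm _)); rewrite expnS mulnC exprM.
have x0_le : x 0%N <= rnorm a ^+ 2 * s.
  have [s1|s1] := eqVneq s 0.
    rewrite s1 mulr0; have := x_le 0%N; rewrite s1 mul0r => h1.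
    by have /eqP : x 0%N ^+ 2 == 0 by [rewrite eq_le h1 sqr_ge0]; move/eqP; rewrite expf_eq0 /= => /eqP ->.
  have sp : 0 < s by rewrite lt_def s1.
  rewrite -ler_pdivrMr//; apply: (@le_of_pow_bound _ _ _ ((rnorm b + 1) / s)).
  - by rewrite divr_ge0 ?snorm_ge0.
  - by rewrite exprn_ge0 ?rnorm_ge0.
  move=> n; rewrite mulrAC ler_pdivlMr//; apply: le_trans (x_ub n).
  rewrite -ler_pdivlMr//.
  elim: n => [|n IH]; first by rewrite expr1.
  rewrite expnS mulnC exprM; apply: (@le_trans _ _ ((x n / s) ^+ 2)).
    by rewrite ler_pXn2r ?nnegrE ?exprn_ge0 ?divr_ge0 ?snorm_ge0.
  rewrite expr_div_n ler_pdivrMr ?exprn_gt0// (le_trans (x_le n))//.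
  by rewrite expr2 mulrA divfK// mulrC.
rewrite -(@ler_pXn2r _ 2)// ?nnegrE ?mulr_ge0 ?snorm_ge0 ?rnorm_ge0//.
apply: (le_trans a_le); apply: (le_trans (ler_wpM2l s0 x0_le)).
by rewrite exprMn mulrCA expr2.
Qed.

End States.

(** * The universal representation of a unital algebra *)

Section Universal.
Context {R : realType} (A : cstarAlgebra R) (u : A) (hu : is_unit u).
Local Notation "a ** b" := (cs_mul a b) (at level 40, left associativity).
Local Notation star := (@cs_star R A).

Record stateT := StateT { st_val :> A -> R[i]; _ : `[< state st_val >] }.

HB.instance Definition _ := [isSub for st_val].
HB.instance Definition _ := [Choice of stateT by <:].

Lemma stateTP (s : stateT) : state s.
Proof. by case: s => s /= /asboolP. Qed.

Definition fin_supp : {pred stateT -> A} := fun f => `[< finite_set [set s | f s != 0] >].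

Lemma fin_supp_submod : submod_closed fin_supp.
Proof.
split; first by apply/asboolP; apply: (sub_finite_set _ (finite_set0 _)) => s /=; rewrite eqxx.
move=> k f g /asboolP hf /asboolP hg; apply/asboolP.
apply: (@sub_finite_set _ _ ([set s | f s != 0] `|` [set s | g s != 0])).
  move=> s /=; apply: contra_neqP => /not_orP[/negP]; rewrite negbK => /eqP fs /negP.
  by rewrite negbK => /eqP gs; rewrite [LHS](_ : _ = k *: f s + g s)// fs gs scaler0 addr0.
by rewrite finite_setU.
Qed.

HB.instance Definition _ := GRing.isSubmodClosed.Build _ _ fin_supp fin_supp_submod.

Record presum := Presum { ps_val :> stateT -> A; _ : ps_val \in fin_supp }.

HB.instance Definition _ := [isSub for ps_val].
HB.instance Definition _ := [Choice of presum by <:].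
HB.instance Definition _ := [SubChoice_isSubLmodule of presum by <:].

Implicit Types f g h : presum.

Lemma ps_finite f : finite_set [set s | f s != 0].
Proof. by case: f => f /= /asboolP. Qed.

Let sform f g : R[i] := \sum_(s \in [set s | f s != 0]) st_val s (star (g s) ** f s).

(** Terms outside the support of [f] vanish. Summing over a common finite set makes linearity and
    symmetry termwise statements. *)
Let sform_on (D : set stateT) f g : finite_set D -> [set s | f s != 0] `<=` D ->
  sform f g = \sum_(s <- finmap.enum_fset (fset_set D)) st_val s (star (g s) ** f s).
Proof.
move=> fD sD; rewrite -fsbig_finite// /sform; apply: fsbig_widen => // s [_ /= /negP].
by rewrite negbK => /eqP fs /=; rewrite fs cs_mul0r (state_0 (stateTP s)).
Qed.

Let sform_linear k f g h : sform (k *: f + g) h = k * sform f h + sform g h.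
Proof.
pose D := [set s | f s != 0] `|` [set s | g s != 0].
have fD : finite_set D by rewrite finite_setU; split; exact: ps_finite.
have sf : [set s | f s != 0] `<=` D by move=> s; left.
have sg : [set s | g s != 0] `<=` D by move=> s; right.
have sfg : [set s | (k *: f + g) s != 0] `<=` D.
  move=> s /=; apply: contra_neqP => /not_orP[/negP/negPn/eqP fs /negP/negPn/eqP gs].
  by rewrite -[LHS]/(k *: f s + g s) fs gs scaler0 addr0.
rewrite (sform_on _ fD sfg) (sform_on _ fD sf) (sform_on _ fD sg).
rewrite mulr_sumr -big_split /=; apply: eq_bigr => s _.
by rewrite -[X in cs_mul _ X]/(k *: f s + g s) cs_mulDr cs_scaleAr (state_lin (stateTP s)).
Qed.

Let sform_herm f g : sform f g = Num.conj (sform g f).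
Proof.
pose D := [set s | f s != 0] `|` [set s | g s != 0].
have fD : finite_set D by rewrite finite_setU; split; exact: ps_finite.
have sf : [set s | f s != 0] `<=` D by move=> s; left.
have sg : [set s | g s != 0] `<=` D by move=> s; right.
rewrite (sform_on _ fD sf) (sform_on _ fD sg).
rewrite rmorph_sum; apply: eq_bigr => s _.
exact: (@ph_herm _ (state_pre (stateTP s))).
Qed.

Let sform_ge0 f : 0 <= sform f f.
Proof.
by rewrite (@sform_on _ f f (ps_finite f))//; apply: sumr_ge0 => s _; exact: state_ge0 (stateTP s) _.
Qed.

Definition universal_pre : preHilbert R :=
  @PreHilbert R presum sform sform_linear sform_herm sform_ge0.

Local Notation V := universal_pre.
Local Notation H := (completion_hilbert V).

Let lmul_supp a f : (fun s => a ** f s) \in fin_supp.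
Proof.
apply/asboolP; apply: sub_finite_set (ps_finite f) => s /=.
by apply: contra_neq => ->; rewrite cs_mul0r.
Qed.

Definition lmul a : V -> V := fun f => Presum (lmul_supp a f).

Let lmulE a f s : (lmul a f : presum) s = a ** f s. Proof. by []. Qed.

Let lmul_adj a (f g : V) : ph_form (lmul a f) g = ph_form f (lmul (star a) g).
Proof.
rewrite /ph_form /= (@sform_on _ f _ (ps_finite f))// (@sform_on _ (lmul a f) _ (ps_finite f)).
  by apply: eq_bigr => s _; rewrite !lmulE cs_starM cs_starK cs_mulA.
by move=> s /=; apply: contra_neq => ->; rewrite cs_mul0r.
Qed.

(** The bound [state_mul_le] is applied at each state and its square summed. *)
Let lmul_le a (f : V) : snorm (lmul a f) <= rnorm a * snorm f.
Proof.
rewrite -(@ler_pXn2r _ 2)// ?nnegrE ?mulr_ge0 ?snorm_ge0 ?rnorm_ge0//.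
rewrite exprMn !snorm_sqr -lecR.
have -> : (complex.Re (ph_form (lmul a f) (lmul a f)))%:C = ph_form (lmul a f) (lmul a f).
  by case: (ge0_Re (ph_ge0 (lmul a f))).
have f2 : (complex.Re (ph_form f f))%:C = ph_form f f by case: (ge0_Re (ph_ge0 f)).
rewrite rmorphM /= f2 /ph_form /= (@sform_on _ f _ (ps_finite f))//.
rewrite (@sform_on _ (lmul a f) _ (ps_finite f)); last first.
  by move=> s /=; apply: contra_neq => ->; rewrite cs_mul0r.
rewrite mulr_sumr; apply: ler_sum => s _; rewrite lmulE.
have le1 : snorm (a ** ps_val f s : state_pre (stateTP s)) ^+ 2
    <= (rnorm a * snorm (ps_val f s : state_pre (stateTP s))) ^+ 2.
  by rewrite ler_pXn2r ?nnegrE ?mulr_ge0 ?snorm_ge0 ?rnorm_ge0// state_mul_le.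
by move: le1; rewrite exprMn -lecR [leRHS]rmorphM /= -!snormE !state_preE.
Qed.

Let lmul_star_le a (f : V) : snorm (lmul (star a) f) <= rnorm a * snorm f.
Proof. by rewrite -(cs_rnorm_star a) lmul_le. Qed.

Definition urep (a : A) : H -> H :=
  clift (lmul_adj a) (rnorm_ge0 a) (lmul_star_le a).

Let urepE a F y : cval (urep a F) y = cval F (lmul (star a) y).
Proof. by []. Qed.

Let urep_incl a (f : V) : urep a (cincl f) = cincl (lmul a f).
Proof. by apply: cval_inj => y; rewrite urepE !cval_incl lmul_adj. Qed.

Lemma urep_le a (F : H) : rnorm (urep a F) <= rnorm a * rnorm F.
Proof. exact: clift_le. Qed.

Let urep_representation : representation urep.
Proof.
split.
- move=> a; split; first by move=> k F G; apply: cval_inj => y.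
  by exists (rnorm a)%:C => F; rewrite !rnormE -rmorphM lecR urep_le.
- move=> k a b F; apply: cval_inj => y; rewrite cval_lin !urepE.
  have -> : lmul (star (k *: a + b)) y = Num.conj k *: lmul (star a) y + lmul (star b) y.
    by apply/val_inj/funext => s; rewrite /= cs_starD cs_starZ cs_mulZl.
  by rewrite cval_anti conjCK.
- move=> a b F; apply: cval_inj => y; rewrite !urepE; congr (cval F _).
  by apply/val_inj/funext => s; rewrite /= cs_starM cs_mulA.
move=> a F G.
(* The adjoint relation holds by construction when [G] comes from a finitely supported function;
   density and boundedness give the rest. *)
apply: (@normc_eps_eq _ _ _ (2 * rnorm a * rnorm F)) => e e0 _.
have [v hv] := cincl_dense G e0.
have E : hs_inner H (urep (star a) F) (cincl v) = hs_inner H F (urep a (cincl v)).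
  by rewrite urep_incl /= !cinner_incl urepE cs_starK.
have urepB (x y : H) : urep a (x - y) = urep a x - urep a y by apply: cval_inj.
have -> : hs_inner H (urep (star a) F) G - hs_inner H F (urep a G)
    = hs_inner H (urep (star a) F) (G - cincl v) + - hs_inner H F (urep a (G - cincl v)).
  by rewrite urepB !innerBr E; ring.
apply: (le_trans (normcD _ _)); rewrite normcN.
apply: (le_trans (lerD (inner_CS _ _) (inner_CS _ _))).
have f1 := urep_le (star a) F; have f2 := urep_le a (G - cincl v).
rewrite cs_rnorm_star in f1.
rewrite (_ : 2 * _ * _ * e = rnorm a * rnorm F * e + rnorm F * (rnorm a * e)); last by ring.
apply: lerD; first by rewrite ler_pM ?rnorm_ge0.
by rewrite ler_wpM2l ?rnorm_ge0// (le_trans f2)// ler_wpM2l ?rnorm_ge0.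
Qed.

Let delta_supp (s : stateT) (a : A) : (fun t => if t == s then a else 0) \in fin_supp.
Proof.
apply/asboolP; apply: (@sub_finite_set _ _ [set s]) (finite_set1 s) => t /=.
by have [//|_] := eqVneq t s; rewrite eqxx.
Qed.

Definition delta (s : stateT) (a : A) : V := Presum (delta_supp s a).

Let lmul_delta a s b : lmul a (delta s b) = delta s (a ** b).
Proof.
by apply/val_inj/funext => t /=; case: eqP => // _; rewrite cs_mul0r.
Qed.

Let form_delta s a (f : V) : ph_form (delta s a) f = st_val s (star ((f : presum) s) ** a).
Proof.
rewrite /ph_form /= (@sform_on [set s])//.
  rewrite -fsbig_finite ?fsbig_set1 /=; last exact: finite_set1. by rewrite eqxx.
by move=> t /=; have [//|_] := eqVneq t s; rewrite eqxx.
Qed.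

(** The cyclic vector of a state is the unit [u] placed at the index of that state. *)
Definition uvec (phi : A -> R[i]) : H :=
  if pselect (state phi) is left h then cincl (delta (StateT (asboolT h)) u) else 0.

Let uvecE (s : stateT) : uvec s = cincl (delta s u).
Proof.
rewrite /uvec; case: pselect => [h|]; last by case; exact: stateTP.
by congr (cincl (delta _ u)); apply: val_inj.
Qed.

Let state_stateT phi : state phi -> exists s : stateT, st_val s = phi.
Proof. by move=> h; exists (StateT (asboolT h)). Qed.

Let urep_uvec a (s : stateT) : urep a (uvec s) = cincl (delta s a).
Proof. by rewrite uvecE urep_incl lmul_delta (hu a).2. Qed.

Let ugns (phi : A -> R[i]) : set H := closure (range (fun a => urep a (uvec phi))).

Let ucyclic phi : state phi -> ugns phi (uvec phi).
Proof.
move=> /state_stateT[s <-]; apply: subset_closure; exists u => //.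
by rewrite urep_uvec uvecE.
Qed.

Let ustate phi : state phi -> forall a, hs_inner H (urep a (uvec phi)) (uvec phi) = phi a.
Proof.
move=> /state_stateT[s <-] a; rewrite urep_uvec uvecE /= cinner_incl cval_incl form_delta /=.
by rewrite eqxx (is_unit_star hu) (hu a).1.
Qed.

(** Generators at distinct states have disjoint supports; orthogonality passes to the closures one
    argument at a time. *)
Let uorth phi psi : state phi -> state psi -> phi <> psi ->
  forall x y, ugns phi x -> ugns psi y -> hs_inner H x y = 0.
Proof.
move=> /state_stateT[s <-] /state_stateT[t <-] st x y gx gy.
apply: (closure_orthogonal gx) => _ [a _ <-].
rewrite inner_herm (_ : hs_inner H y _ = 0) ?rmorph0//.
apply: (closure_orthogonal gy) => _ [b _ <-].
rewrite !urep_uvec /= cinner_incl cval_incl form_delta /=.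
case: eqP => [ts|_]; first by case: st; rewrite ts.
by rewrite cs_star0 cs_mul0l (state_0 (stateTP _)).
Qed.

Let utotal : closure
    [set x : H | exists (n : nat) (phi : 'I_n -> A -> R[i]) (v : 'I_n -> H),
       (forall i, state (phi i) /\ ugns (phi i) (v i)) /\
       x = \sum_(i < n) v i] = setT.
Proof.
apply/seteqP; split => // F _; apply: closure_rnorm => e e0.
have [v hv] := cincl_dense F (divr_gt0 e0 (ltr0Sn _ 1)).
exists (cincl v); last first.
  apply: (le_lt_trans hv); rewrite ltr_pdivrMr// mulr_natr mulr2n ltrDl//.
(* A finitely supported function is the sum of its components over its support. *)
pose r : seq stateT := finmap.enum_fset (fset_set [set s | (v : presum) s != 0]).
exists (size r), (fun i => st_val (tnth (in_tuple r) i)).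
exists (fun i => cincl (delta (tnth (in_tuple r) i) ((v : presum) (tnth (in_tuple r) i)))).
split.
  move=> i; split; first exact: stateTP.
  by apply: subset_closure; exists ((v : presum) (tnth (in_tuple r) i)) => //; rewrite urep_uvec.
rewrite -(big_tuple _ _ (in_tuple r) xpredT (fun s => cincl (delta s ((v : presum) s)))) /=.
have lin (k : seq stateT) : \sum_(s <- k) cincl (delta s ((v : presum) s))
     = cincl (\sum_(s <- k) delta s ((v : presum) s)).
  elim: k => [|s k IH]; rewrite ?big_nil ?big_cons.
    by apply: cval_inj => y; rewrite cval_incl ph_form0l.
  by rewrite IH -[X in X + _]scale1r -cincl_lin scale1r.
rewrite lin; congr cincl; apply/val_inj/funext => t.
have -> : \val (\sum_(s <- r) delta s ((v : presum) s)) t =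
   \sum_(s <- r) (if t == s then (v : presum) s else 0).
  by elim: r => [|s k IH]; rewrite ?big_nil// !big_cons -IH.
have [tr|tr] := boolP (t \in r).
  rewrite (bigD1_seq t)//= ?eqxx ?big1 ?addr0//; last exact: finmap.fset_uniq.
  by move=> s; rewrite eq_sym => /negPf ->.
rewrite big_seq big1; last by move=> s sr; case: eqP => // ts; rewrite ts sr in tr.
apply/eqP; apply: contraNT tr => vt; rewrite in_fset_set; last exact: ps_finite.
by rewrite inE.
Qed.

Definition universal_rep : universalRep A :=
  UniversalRep urep_representation ucyclic ustate uorth utotal.

(** Contractivity and the preservation of the unit are what the example uses of this construction
    beyond the fields of [universalRep]; they reappear as the hypotheses [hc] and [hone]. *)
Lemma universal_rep_le a x : rnorm (@ur_rep R A universal_rep a x) <= rnorm a * rnorm x.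
Proof. exact: urep_le. Qed.

Lemma universal_rep_unit x : @ur_rep R A universal_rep u x = x.
Proof.
apply: cval_inj => y; rewrite urepE (is_unit_star hu); congr (cval x _).
by apply/val_inj/funext => s; rewrite /= (hu _).1.
Qed.

End Universal.

(** * Algebras of matrix-valued functions *)

Section Rows.
Context {R : realType} {n : nat}.
Implicit Types (x y z : 'rV[R[i]]_n) (a b : 'M[R[i]]_n).

Definition rdot x y : R[i] := \sum_(j < n) x 0 j * (y 0 j)^*.

Let rdot_linear k x y z : rdot (k *: x + y) z = k * rdot x z + rdot y z.
Proof.
rewrite /rdot mulr_sumr -big_split /=; apply: eq_bigr => j _.
by rewrite !mxE mulrDl mulrA.
Qed.

Let rdot_herm x y : rdot x y = Num.conj (rdot y x).
Proof.
rewrite /rdot rmorph_sum; apply: eq_bigr => j _.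
by rewrite rmorphM /= conjCK mulrC.
Qed.

Let rdot_ge0 x : 0 <= rdot x x.
Proof. by apply: sumr_ge0 => j _; rewrite mul_conjC_ge0. Qed.

Definition rows : preHilbert R := PreHilbert rdot_linear rdot_herm rdot_ge0.

Definition adjmx a : 'M[R[i]]_n := \matrix_(i, j) (a j i)^*.

Lemma rdot_adj a x y : ph_form (x *m a : rows) y = ph_form (x : rows) (y *m adjmx a).
Proof.
rewrite /ph_form /= /rdot.
under eq_bigr do rewrite mxE mulr_suml.
rewrite exchange_big /=; apply: eq_bigr => j _.
rewrite mxE rmorph_sum mulr_sumr; apply: eq_bigr => k _.
by rewrite mxE rmorphM /= conjCK -mulrA [a j k * _]mulrC.
Qed.

Lemma adjmxK a : adjmx (adjmx a) = a.
Proof. by apply/matrixP => i j; rewrite !mxE conjCK. Qed.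

Lemma adjmxD a b : adjmx (a + b) = adjmx a + adjmx b.
Proof. by apply/matrixP => i j; rewrite !mxE rmorphD. Qed.

Lemma adjmxB a b : adjmx (a - b) = adjmx a - adjmx b.
Proof. by apply/matrixP => i j; rewrite !mxE rmorphB. Qed.

Lemma adjmxZ k a : adjmx (k *: a) = k^* *: adjmx a.
Proof. by apply/matrixP => i j; rewrite !mxE rmorphM. Qed.

Lemma adjmxM a b : adjmx (a *m b) = adjmx b *m adjmx a.
Proof.
apply/matrixP => i j; rewrite !mxE rmorph_sum; apply: eq_bigr => k _.
by rewrite !mxE rmorphM mulrC.
Qed.

Lemma adjmx1 : adjmx 1%:M = 1%:M.
Proof. by apply/matrixP => i j; rewrite !mxE conjC_nat eq_sym. Qed.

(** Bounds on the operator norm are kept as a relation, so that no norm on matrices has to be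
    defined. *)
Definition opb a (M : R) := forall x, snorm (x *m a : rows) <= M * snorm (x : rows).

Lemma opb_form a (M : R) : 0 <= M ->
  (forall x y, normc (ph_form (x *m a : rows) y) <= M * (snorm (x : rows) * snorm (y : rows)))
  -> opb a M.
Proof.
move=> M0 h x; apply: snorm_le => [|y]; first by rewrite mulr_ge0 ?snorm_ge0.
by rewrite -mulrA; exact: h.
Qed.

Lemma form_opb a (M : R) x y : opb a M ->
  normc (ph_form (x *m a : rows) y) <= M * (snorm (x : rows) * snorm (y : rows)).
Proof.
move=> aM; apply: (le_trans (ph_CauchySchwarz _ _)).
by rewrite mulrA ler_wpM2r ?snorm_ge0.
Qed.

(** A bound on the form is symmetric under exchanging [a] and its adjoint. *)
Lemma opb_adj a (M : R) : 0 <= M -> opb a M -> opb (adjmx a) M.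
Proof.
move=> M0 aM; apply: opb_form => // x y.
by rewrite rdot_adj adjmxK ph_herm normc_conj [X in M * X]mulrC form_opb.
Qed.

Lemma opbD a b (M N : R) : opb a M -> opb b N -> opb (a + b) (M + N).
Proof.
move=> aM bN x; rewrite mulmxDr mulrDl; apply: (le_trans (snormD _ _)).
exact: lerD.
Qed.

Lemma opbM a b (M N : R) : 0 <= N -> opb a M -> opb b N -> opb (a *m b) (M * N).
Proof.
move=> N0 aM bN x; rewrite mulmxA; apply: (le_trans (bN _)).
by rewrite [M * N]mulrC -mulrA ler_wpM2l.
Qed.

Lemma opbZ k a (M : R) : opb a M -> opb (k *: a) (normc k * M).
Proof.
move=> aM x; rewrite -scalemxAr (@snormZ _ rows) -mulrA.
by rewrite ler_wpM2l ?normc_ge0//; exact: aM.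
Qed.

Lemma opb0 : opb 0 0.
Proof. by move=> x; rewrite mulmx0 mul0r /snorm ph_form0l /= sqrtr0. Qed.

Lemma opb1 : opb 1%:M 1.
Proof. by move=> x; rewrite mulmx1 mul1r. Qed.

Lemma opb_le a (M N : R) : M <= N -> opb a M -> opb a N.
Proof. by move=> MN aM x; apply: (le_trans (aM x)); rewrite ler_wpM2r ?snorm_ge0. Qed.

(** For a projection, the square of the norm of [x a] is the form of [x] and [x a], to which
    Cauchy-Schwarz applies. *)
Lemma opb_proj a : adjmx a = a -> a *m a = a -> opb a 1.
Proof.
move=> ad idem x; rewrite mul1r.
have [s0|s0] := eqVneq (snorm (x *m a : rows)) 0; first by rewrite s0 snorm_ge0.
have sp : 0 < snorm (x *m a : rows) by rewrite lt_def s0 snorm_ge0.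
rewrite -(ler_pM2r sp) -expr2 snorm_sqr rdot_adj ad -mulmxA idem.
by apply: (le_trans (Re_le_normc _)); exact: ph_CauchySchwarz.
Qed.

End Rows.
Arguments rows {R} n.

(** * The C*-algebra of bounded matrix-valued functions with a continuity condition *)

Section MatrixFunctions.
Context {R : realType} (n : nat) (I : Type) (G : set_system (I * I)) (FG : Filter G).
Local Notation C := R[i].

(* [G] plays the role of a uniform structure: the functions vary less and less
   along the pairs of [G]. *)
Definition ucont : {pred I -> 'M[C]_n} := fun a =>
  `[< (exists2 M : R, 0 <= M & forall i, opb (a i) M) /\
      forall e : R, 0 < e -> G [set ij | opb (a ij.1 - a ij.2) e] >].

Lemma ucont_submod : submod_closed ucont.
Proof.
split.
  apply/asboolP; split; first by exists 0 => // i; exact: opb0.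
  move=> e e0; apply: filterS filterT => -[i j] _ /=; rewrite subrr.
  by apply: opb_le opb0; exact: ltW.
move=> k a b /asboolP[[M M0 aM] aG] /asboolP[[N N0 bN] bG]; apply/asboolP; split.
  exists (normc k * M + N); first by rewrite addr_ge0 ?mulr_ge0 ?normc_ge0.
  by move=> i; apply: opbD => //; exact: opbZ.
move=> e e0; pose d := e / 2 / (1 + normc k).
have k0 : 0 < 1 + normc k by rewrite ltr_pwDl ?normc_ge0.
have e2 : 0 < e / 2 by rewrite divr_gt0.
apply: filterS (filterI (aG d (divr_gt0 e2 k0)) (bG _ e2)) => -[i j] /= [ha hb].
rewrite [X in opb X](_ : _ = k *: (a i - a j) + (b i - b j)); last first.
  by rewrite -![(k *: a + b) _]/(k *: a _ + b _) scalerBr opprD addrACA.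
apply: (@opb_le _ _ _ (normc k * d + e / 2)); last by apply: opbD => //; exact: opbZ.
rewrite [leRHS]splitr lerD2r /d mulrCA ler_piMr ?(ltW e2)//.
by rewrite ler_pdivrMr// mul1r lerDr.
Qed.

HB.instance Definition _ := GRing.isSubmodClosed.Build _ _ ucont ucont_submod.

Record mfun := MFun { mf_val :> I -> 'M[C]_n; _ : mf_val \in ucont }.

HB.instance Definition _ := [isSub for mf_val].
HB.instance Definition _ := [Choice of mfun by <:].
HB.instance Definition _ := [SubChoice_isSubLmodule of mfun by <:].

Lemma mf_bnd (a : mfun) : exists2 M : R, 0 <= M & forall i, opb (a i) M.
Proof. by case: a => a /= /asboolP[]. Qed.

Lemma mf_ucont (a : mfun) (e : R) : 0 < e -> G [set ij | opb (a ij.1 - a ij.2) e].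
Proof. by case: a => a /= /asboolP[_]; apply. Qed.

(** Indexing by a point and two rows, weighted by the product of their norms, makes the weighted
    supremum norm the supremum of the operator norms of the values. *)
Let idx := (I * (rows (R := R) n * rows (R := R) n))%type.
Let ev (a : mfun) (t : idx) : C := ph_form (t.2.1 *m a t.1 : rows n) t.2.2.
Let rho (t : idx) : R := snorm t.2.1 * snorm t.2.2.

Let ev_lin k (a b : mfun) t : ev (k *: a + b) t = k * ev a t + ev b t.
Proof.
rewrite /ev -[mf_val (k *: a + b) t.1]/(k *: a t.1 + b t.1) mulmxDr -scalemxAr.
exact: ph_linear.
Qed.

Let rho_ge0 t : 0 <= rho t. Proof. by rewrite mulr_ge0 ?snorm_ge0. Qed.

Let ev_bnd (a : mfun) : exists M, 0 <= M /\ forall t, normc (ev a t) <= M * rho t.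
Proof. by have [M M0 aM] := mf_bnd a; exists M; split=> // t; exact: form_opb. Qed.

Let form_entry (x y : 'rV[C]_n) (m : 'M[C]_n) :
  ph_form (x *m m : rows n) y = \sum_j \sum_k x 0 j * (y 0 k)^* * m j k.
Proof.
rewrite /ph_form /= /rdot exchange_big /=; apply: eq_bigr => k _.
by rewrite mxE mulr_suml; apply: eq_bigr => j _; rewrite mulrAC.
Qed.

Let entry_form (m : 'M[C]_n) j k :
  ph_form (delta_mx 0 j *m m : rows n) (delta_mx 0 k) = m j k.
Proof.
rewrite form_entry (bigD1 j)//= (bigD1 k)//= !mxE !eqxx conjC1 !mul1r.
rewrite !big1 ?addr0// => [j' /negPf jj|k' /negPf kk]; last first.
  by rewrite !mxE eqxx kk conjC0 mulr0 mul0r.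
by rewrite big1// => k' _; rewrite !mxE jj andbF !mul0r.
Qed.

Let ev_inj (a : mfun) : (forall t, ev a t = 0) -> a = 0.
Proof.
move=> a0; apply/val_inj/funext => i; apply/matrixP => j k.
have := a0 (i, (delta_mx 0 j, delta_mx 0 k)); rewrite /ev entry_form /= => ->.
by rewrite -[RHS]/((0 : 'M[C]_n) j k) mxE.
Qed.

(** The limit matrices are read off from [g] at the basis vectors. The function [g] agrees with
    their forms because both are limits of the same forms. *)
Let ev_closed (g : idx -> C) :
  (forall e, 0 < e -> exists a, forall t, normc (g t - ev a t) <= e * rho t) ->
  exists a, ev a = g.
Proof.
move=> hg; pose e_ j : @rows R n := delta_mx 0 j.
pose m i : 'M[C]_n := \matrix_(j, k) g (i, (e_ j, e_ k)).
have mE i (x y : rows n) : ph_form (x *m m i : rows n) y = g (i, (x, y)).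
  apply: (@normc_eps_eq _ _ _ (snorm x * snorm y +
     \sum_j \sum_k normc (x 0 j) * normc (y 0 k) * (snorm (e_ j) * snorm (e_ k)))).
  move=> e e0 _; have [a ha] := hg e e0; rewrite normcB.
  have -> : g (i, (x, y)) - ph_form (x *m m i : rows n) y
      = (g (i, (x, y)) - ev a (i, (x, y)))
        + \sum_j \sum_k x 0 j * (y 0 k)^* * (ev a (i, (e_ j, e_ k)) - g (i, (e_ j, e_ k))).
    have -> : ph_form (x *m m i : rows n) y = ev a (i, (x, y))
        - \sum_j \sum_k x 0 j * (y 0 k)^* * (ev a (i, (e_ j, e_ k)) - g (i, (e_ j, e_ k))).
      have -> : ev a (i, (x, y)) = \sum_j \sum_k x 0 j * (y 0 k)^* * a i j k.
        exact: form_entry.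
      rewrite form_entry -sumrB; apply: eq_bigr => j _.
      rewrite -sumrB; apply: eq_bigr => k _.
      have -> : ev a (i, (e_ j, e_ k)) = a i j k by exact: entry_form.
      by rewrite mxE; ring.
    by rewrite opprD opprK addrA.
  have nsum (J : finType) (f : J -> C) : normc (\sum_j f j) <= \sum_j normc (f j).
    elim/big_rec2: _ => [|j s z _ h]; first by rewrite ComplexField.Normc.normc0.
    by apply: (le_trans (normcD _ _)); rewrite lerD2l.
  apply: (le_trans (normcD _ _)); rewrite mulrDl; apply: lerD.
    by apply: (le_trans (ha _)); rewrite mulrC.
  apply: (le_trans (nsum _ _)); rewrite mulr_suml; apply: ler_sum => j _.
  apply: (le_trans (nsum _ _)); rewrite mulr_suml; apply: ler_sum => k _.
  rewrite !ComplexField.Normc.normcM normc_conj -mulrA [X in _ <= X]mulrAC -!mulrA.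
  rewrite !ler_wpM2l ?normc_ge0// normcB; apply: (le_trans (ha _)).
  by rewrite /rho /= mulrA mulrC.
have mb e : 0 < e -> exists a : mfun, forall i, opb (m i - a i) e.
  move=> e0; have [a ha] := hg e e0; exists a => i; apply: opb_form; first exact: ltW.
  move=> x y; rewrite mulmxBr (@ph_formBl _ (rows n)) mE.
  exact: (ha (i, (x, y))).
have mP : m \in ucont.
  apply/asboolP; split.
    have [a ha] := mb 1 ltr01; have [M M0 aM] := mf_bnd a.
    exists (1 + M); first by rewrite addr_ge0.
    by move=> i; rewrite -[m i](subrK (a i)); exact: opbD.
  move=> e e0; have e3 : 0 < e / 3 by rewrite divr_gt0.
  have [a ha] := mb _ e3; apply: filterS (mf_ucont a e3) => -[i j] /= aij.
  rewrite (_ : m i - m j = (m i - a i) + ((a i - a j) + (-1) *: (m j - a j))); last first.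
    by rewrite scaleN1r opprB addrA !subrKA.
  apply: (@opb_le _ _ _ (e / 3 + (e / 3 + normc (-1 : C) * (e / 3)))).
    by rewrite normcN ComplexField.Normc.normc1; lra.
  exact: opbD (ha i) (opbD aij (opbZ _ (ha j))).
by exists (MFun mP); apply/funext => -[i [x y]]; rewrite -mE.
Qed.

Definition mf_data : normData R := NormData ev_lin rho_ge0 ev_bnd ev_inj ev_closed.

Local Notation A := (wspace mf_data).

Let mfat (a : A) : I -> 'M[C]_n := mf_val a.

Lemma mf_norm_le (a : A) (M : R) : 0 <= M -> (forall i, opb (mf_val a i) M) -> wnorm a <= M.
Proof. by move=> M0 aM; apply: wnorm_le => // t; exact: form_opb. Qed.

Lemma mf_normP (a : A) i : opb (mf_val a i) (wnorm a).
Proof.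
apply: opb_form => [|x y]; first exact: wnorm_ge0.
exact: (wnormP a (i, (x, y))).
Qed.

Let mul_ucont (a b : A) : (fun i => mfat a i *m mfat b i) \in ucont.
Proof.
apply/asboolP; split.
  exists (wnorm a * wnorm b); first by rewrite mulr_ge0 ?wnorm_ge0.
  by move=> i; apply: opbM; [exact: wnorm_ge0 | exact: mf_normP..].
move=> e e0; pose M := 1 + wnorm a + wnorm b.
have M0 : 0 < M by rewrite /M -addrA ltr_pwDl ?addr_ge0 ?wnorm_ge0.
pose d := e / (2 * M); have d0 : 0 < d by rewrite divr_gt0 ?mulr_gt0.
apply: filterS (filterI (mf_ucont a d0) (mf_ucont b d0)) => -[i j] /= [ha hb].
rewrite (_ : _ - _ = (mfat a i - mfat a j) *m mfat b i + mfat a j *m (mfat b i - mfat b j)); last first.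
  by rewrite mulmxBl mulmxBr subrKA.
apply: (@opb_le _ _ _ (d * wnorm b + wnorm a * d)); last first.
  exact: opbD (opbM (wnorm_ge0 b) ha (mf_normP b i)) (opbM (ltW d0) (mf_normP a j) hb).
rewrite [wnorm a * d]mulrC -mulrDr /d mulrAC ler_pdivrMr ?mulr_gt0// ler_wpM2l ?(ltW e0)//.
by have := wnorm_ge0 a; have := wnorm_ge0 b; rewrite /M; lra.
Qed.

Let star_ucont (a : A) : (fun i => adjmx (mfat a i)) \in ucont.
Proof.
apply/asboolP; split.
  exists (wnorm a); first exact: wnorm_ge0.
  by move=> i; apply: opb_adj; [exact: wnorm_ge0 | exact: mf_normP].
move=> e e0; apply: filterS (mf_ucont a e0) => -[i j] /= h.
by rewrite -adjmxB; apply: opb_adj => //; exact: ltW.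
Qed.

Definition mf_mul (a b : A) : A := MFun (mul_ucont a b).
Definition mf_star (a : A) : A := MFun (star_ucont a).

Let mf_ext (a b : A) : (forall i, mfat a i = mfat b i) -> a = b.
Proof. by move=> ab; apply/val_inj/funext. Qed.

Let mf_norm_mul (a b : A) : wnorm (mf_mul a b) <= wnorm a * wnorm b.
Proof.
apply: mf_norm_le; first by rewrite mulr_ge0 ?wnorm_ge0.
by move=> i; apply: opbM; [exact: wnorm_ge0 | exact: mf_normP..].
Qed.

Let mf_norm_star_le (a : A) : wnorm (mf_star a) <= wnorm a.
Proof.
apply: mf_norm_le; first exact: wnorm_ge0.
by move=> i; apply: opb_adj; [exact: wnorm_ge0 | exact: mf_normP].
Qed.

Let mf_starK : involutive mf_star.
Proof. by move=> a; apply: mf_ext => i; exact: adjmxK. Qed.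

Let mf_norm_star (a : A) : wnorm (mf_star a) = wnorm a.
Proof. by apply/eqP; rewrite eq_le mf_norm_star_le -{1}[a]mf_starK mf_norm_star_le. Qed.

Let mf_cstar (a : A) : wnorm (mf_mul (mf_star a) a) = wnorm a ^+ 2.
Proof.
apply/eqP; rewrite eq_le; apply/andP; split.
  by apply: (le_trans (mf_norm_mul _ _)); rewrite mf_norm_star.
set N := wnorm (mf_mul _ _); have N0 : 0 <= N by exact: wnorm_ge0.
rewrite -(sqr_sqrtr N0). rewrite ler_pXn2r ?nnegrE ?wnorm_ge0 ?sqrtr_ge0//.
(* Rows are multiplied on the right, so the product of [mf_star a] and [a] controls first the norm
   of [mf_star a]. *)
rewrite -mf_norm_star; apply: mf_norm_le; first exact: sqrtr_ge0.
move=> i x; rewrite -(@ler_pXn2r _ 2)// ?nnegrE ?mulr_ge0 ?snorm_ge0 ?sqrtr_ge0//.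
rewrite exprMn (sqr_sqrtr N0) snorm_sqr rdot_adj -[mf_val (mf_star a) i]/(adjmx (mfat a i)) adjmxK.
apply: (le_trans (Re_le_normc _)); rewrite ph_herm normc_conj -mulmxA expr2.
exact: (wnormP (mf_mul (mf_star a) a) (i, (x, x))).
Qed.

Lemma mf_cs_normM (a b : A) : `|mf_mul a b| <= `|a| * `|b|.
Proof. by rewrite !wnormE -rmorphM lecR. Qed.

Lemma mf_cs_norm_star (a : A) : `|mf_mul (mf_star a) a| = `|a| ^+ 2.
Proof. by rewrite !wnormE mf_cstar rmorphXn. Qed.

Program Definition mf_algebra : cstarAlgebra R :=
  @CStarAlgebra R A mf_mul mf_star _ _ _ _ _ mf_cs_normM mf_starK _ _ _ mf_cs_norm_star.
Next Obligation. by move=> a b c; apply: mf_ext => i; exact: mulmxA. Qed.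
Next Obligation. by move=> a b c; apply: mf_ext => i; exact: mulmxDl. Qed.
Next Obligation. by move=> a b c; apply: mf_ext => i; exact: mulmxDr. Qed.
Next Obligation.
move=> k a b; apply: mf_ext => i.
by rewrite -[LHS]/((k *: mfat a i) *m mfat b i) -scalemxAl.
Qed.
Next Obligation.
move=> k a b; apply: mf_ext => i.
by rewrite -[LHS]/(mfat a i *m (k *: mfat b i)) -scalemxAr.
Qed.
Next Obligation.
by move=> a b; apply: mf_ext => i; rewrite -[LHS]/(adjmx (mfat a i + mfat b i)) adjmxD.
Qed.
Next Obligation.
by move=> k a; apply: mf_ext => i; rewrite -[LHS]/(adjmx (k *: mfat a i)) adjmxZ.
Qed.
Next Obligation. by move=> a b; apply: mf_ext => i; exact: adjmxM. Qed.

Definition mval (a : mf_algebra) : I -> 'M[C]_n := mf_val a.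

Lemma mvalP (a b : mf_algebra) : (forall i, mval a i = mval b i) -> a = b.
Proof. exact: mf_ext. Qed.

Lemma mvalM (a b : mf_algebra) i : mval (cs_mul a b) i = mval a i *m mval b i.
Proof. by []. Qed.

Lemma mval_star (a : mf_algebra) i : mval (cs_star a) i = adjmx (mval a i).
Proof. by []. Qed.

Lemma mvalB (a b : mf_algebra) i : mval (a - b) i = mval a i - mval b i.
Proof. by []. Qed.

Lemma mval_opb (a : mf_algebra) i : opb (mval a i) (rnorm a).
Proof. exact: mf_normP. Qed.

Lemma mval_norm_le (a : mf_algebra) (M : R) : 0 <= M ->
  (forall i, opb (mval a i) M) -> rnorm a <= M.
Proof. exact: mf_norm_le. Qed.

Lemma mval_ucont (a : mf_algebra) (e : R) : 0 < e ->
  G [set ij | opb (mval a ij.1 - mval a ij.2) e].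
Proof. exact: mf_ucont. Qed.

Lemma mval_ex (m : I -> 'M[C]_n) (M : R) : 0 <= M -> (forall i, opb (m i) M) ->
  (forall e : R, 0 < e -> G [set ij | opb (m ij.1 - m ij.2) e]) ->
  exists a : mf_algebra, mval a = m.
Proof.
move=> M0 mM mG; have mP : m \in ucont by apply/asboolP; split=> //; exists M.
by exists (MFun mP).
Qed.

(** These states make the value of an element at a single point visible in the universal
    representation. The norm [1] is attained at the constant identity. *)
Lemma vector_state i (x : rows (R := R) n) : snorm x = 1 ->
  state (fun a : mf_algebra => ph_form (x *m mval a i : rows n) x).
Proof.
move=> x1; split.
- by move=> k a b; have := ev_lin k a b (i, (x, x)).
- by move=> a; rewrite mvalM mval_star mulmxA rdot_adj ph_ge0.
apply/eqP; rewrite eq_le; apply/andP; split.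
  apply: ge_ereal_sup => _ [a /= a1 <-]; rewrite lee_fin rnorm_complex.
  apply: (le_trans (form_opb _ _ (mval_opb a i))); rewrite x1 !mulr1.
  by rewrite -lecR -rnormE.
have [u hu] : exists a : mf_algebra, mval a = fun=> 1%:M.
  apply: (@mval_ex _ 1) => // [_|e e0]; first exact: opb1.
  apply: filterS filterT => ij _ /=; rewrite subrr; apply: opb_le opb0.
  exact: ltW.
have u1 : ph_form (x *m mval u i : rows n) x = 1 by rewrite hu mulmx1 snormE x1 expr1n.
apply: ereal_sup_ubound; exists u.
  rewrite /= rnormE -(rmorph1 (real_complex R)) lecR; apply: mval_norm_le => // j.
  by rewrite hu; exact: opb1.
congr (_%:E); rewrite -[LHS]/(normc (ph_form (x *m mval u i : rows n) x)) u1.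
exact: ComplexField.Normc.normc1.
Qed.

End MatrixFunctions.

(** * Strong limits of decreasing projections *)

(** Nonnegativity in [R[i]] includes being real, so the imaginary and real parts are bounded
    separately. *)
Lemma approx_ge0 (R : realType) (z : R[i]) :
  (forall e, 0 < e -> exists2 w, 0 <= w & normc (z - w) <= e) -> 0 <= z.
Proof.
move=> H.
have P e : 0 < e -> `|complex.Im z| <= e /\ - e <= complex.Re z.
  move=> e0; have [w w0 zw] := H e e0; case: (ge0_Re w0) => wE Rw.
  move: zw; rewrite -wE; case: z {H} => a b /= zw; split.
    apply: le_trans zw; rewrite -sqrtr_sqr oppr0 addr0.
    by apply: ler_wsqrtr; rewrite lerDr sqr_ge0.
  have : - (a - complex.Re w) <= e.
    apply: le_trans zw; apply: (le_trans (ler_norm _)); rewrite normrN -sqrtr_sqr.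
    by apply: ler_wsqrtr; rewrite lerDl sqr_ge0.
  by lra.
rewrite lecE /=; apply/andP; split.
  rewrite -normr_eq0 eq_le normr_ge0 andbT; apply/ler_addgt0Pr => e e0.
  by rewrite add0r; case: (P e e0).
by apply/ler_addgt0Pr => e e0; have [_] := P e e0; lra.
Qed.

Lemma rnorm_eps_eq (R : realType) (W : normedModType R[i]) (x y : W) (K : R) :
  (forall e, 0 < e -> rnorm (x - y) <= K * e) -> x = y.
Proof.
move=> H; apply/eqP; rewrite -subr_eq0; apply/eqP/rnorm0_eq0.
apply: complexI; apply: (@normc_eps_eq _ _ _ K) => e e0 _.
by rewrite subr0 normc_real ger0_norm ?rnorm_ge0// H.
Qed.

Section Representations.
Context {R : realType} {A : cstarAlgebra R} (U : universalRep A).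
Local Notation H := (ur_space U).
Local Notation iota := (@ur_rep R A U).
Local Notation inner := (hs_inner H).
Local Notation "a ** b" := (cs_mul a b) (at level 40, left associativity).
Local Notation star := (@cs_star R A).
Implicit Types (a b : A) (x y z : H).

Lemma iota_lin a k x y : iota a (k *: x + y) = k *: iota a x + iota a y.
Proof. by have [/(_ a)[h _] _ _ _] := ur_repP U; exact: h. Qed.

Lemma iotaBr a x y : iota a (x - y) = iota a x - iota a y.
Proof.
by have := iota_lin a (-1) y x; rewrite !scaleN1r addrC => ->; rewrite addrC.
Qed.

Lemma iotaM a b x : iota (a ** b) x = iota a (iota b x).
Proof. by have [_ _ h _] := ur_repP U. Qed.

Lemma iota_star a x y : inner (iota (star a) x) y = inner x (iota a y).
Proof. by have [_ _ _ h] := ur_repP U. Qed.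

Lemma iotaB a b x : iota (a - b) x = iota a x - iota b x.
Proof.
have [_ h _ _] := ur_repP U.
by have := h (-1) b a x; rewrite !scaleN1r addrC => ->; rewrite addrC.
Qed.

Lemma iota_enveloping a : star a = a -> enveloping_sa U (iota a).
Proof.
move=> sa; split; last by move=> x y; rewrite -[in LHS]sa iota_star.
split; first by have [/(_ a)] := ur_repP U.
by move=> S [_ hS]; rewrite hS//; exists a.
Qed.

Definition cs_proj a := star a = a /\ a ** a = a.

Lemma cs_proj_norm a : cs_proj a -> rnorm a <= 1.
Proof.
move=> [sa aa]; have := cs_rnorm_star_mul a; rewrite sa aa => h.
have [->//|a0] := eqVneq (rnorm a) 0.
by rewrite -(mulfK a0 (rnorm a)) -expr2 -h divff.
Qed.

Lemma cs_proj_pos a : cs_proj a -> pos_ball a.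
Proof.
move=> pa; split; first by exists a; rewrite pa.1 pa.2.
by rewrite rnormE -(rmorph1 (real_complex R)) lecR cs_proj_norm.
Qed.

Lemma inner_proj a x : cs_proj a -> inner (iota a x) x = (rnorm (iota a x) ^+ 2)%:C.
Proof.
by move=> [sa aa]; rewrite -inner_sqr -iota_star sa -iotaM aa.
Qed.

Lemma cs_projB a b : cs_proj a -> cs_proj b -> b ** a = a -> cs_proj (b - a).
Proof.
move=> [sa aa] [sb bb] ba; split; first by rewrite cs_starB sa sb.
have ab : a ** b = a by rewrite -[in LHS]sa -[in LHS]sb -cs_starM ba.
by rewrite cs_mulBl !cs_mulBr bb ba ab aa subrr subr0.
Qed.

Lemma iota_le_proj a b : cs_proj a -> cs_proj b -> b ** a = a -> op_le (iota a) (iota b).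
Proof.
move=> pa pb ba x; rewrite -iotaB inner_proj; last exact: cs_projB.
by rewrite ler0c sqr_ge0.
Qed.

(** The difference [D] is self-adjoint and its quadratic form vanishes. At [x + D x] that form
    equals twice the square of the norm of [D x]. *)
Lemma op_le_anti (S T : H -> H) : enveloping_sa U S -> enveloping_sa U T ->
  op_le S T -> op_le T S -> S = T.
Proof.
move=> [[[linS _] _] saS] [[[linT _] _] saT] ST TS.
have [D DE] : exists D : H -> H, forall x, D x = T x - S x by exists (fun x => T x - S x).
have D0 x : inner (D x) x = 0.
  apply/eqP; rewrite DE eq_le ST andbT -oppr_ge0 innerBl opprB -innerBl.
  exact: TS.
have DD x y : D (x + y) = D x + D y.
  rewrite !DE; have := linT 1 x y; have := linS 1 x y; rewrite !scale1r => -> ->.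
  by rewrite opprD addrACA.
have saD x y : inner (D x) y = inner x (D y) by rewrite !DE innerBl saS saT innerBr.
apply/funext => x; apply/eqP; rewrite eq_sym -subr_eq0 -DE; apply/eqP/rnorm0_eq0.
have := D0 (x + D x); rewrite DD innerDl !innerDr !D0 add0r addr0.
rewrite [inner (D (D x)) x]saD inner_sqr -rmorphD => /complexI/eqP.
by rewrite paddr_eq0 ?sqr_ge0// sqrf_eq0 => /andP[/eqP].
Qed.

(** Antisymmetry makes suprema unique, so [xget] can only return [x]. *)
Lemma interior_projE (q x : H -> H) :
  is_sup U (iota @` down U q) x -> interior_proj U q = x.
Proof.
move=> sx; have sg : is_sup U (iota @` down U q) (interior_proj U q) by exact: (@xgetPex _ _ _ (ex_intro _ x sx)).
case: sx sg => [ex ux lx] [eg ug lg].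
by apply: op_le_anti => //; [apply: lg | apply: lx].
Qed.

(* No supremum needs to exist here: the default value [0] of [interior_proj]
   satisfies the bound as well. *)
Lemma interior_proj_le (q z : H -> H) x : enveloping_sa U z ->
  (forall a, down U q a -> op_le (iota a) z) -> inner (z x) x = 0 ->
  inner (interior_proj U q x) x <= 0.
Proof.
move=> ez uz zx; rewrite /interior_proj.
have hz (y : H -> H) : (iota @` down U q) y -> op_le y z by move=> [a ha <-]; exact: uz.
case: xgetP => [y -> [_ _ ly]|_]; last by rewrite inner0l.
by have := ly z ez hz x; rewrite innerBl zx sub0r oppr_ge0.
Qed.

Hypothesis hc : forall a x, rnorm (iota a x) <= rnorm a * rnorm x.

(** Convergence in the strong operator topology. *)
Definition slim (a : nat -> A) (Q : H -> H) := forall x (e : R), 0 < e ->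
  exists N0, forall N, (N0 <= N)%N -> rnorm (Q x - iota (a N) x) <= e.

Section StrongLimit.
Context (a : nat -> A) (Q : H -> H) (aQ : slim a Q).

Lemma slim_inner x y (e : R) : 0 < e ->
  exists N0, forall N, (N0 <= N)%N -> normc (inner (Q x) y - inner (iota (a N) x) y) <= e * rnorm y.
Proof.
move=> e0; have [N0 hN] := aQ x e0; exists N0 => N NN; rewrite -innerBl.
by apply: (le_trans (inner_CS _ _)); rewrite ler_wpM2r ?rnorm_ge0 ?hN.
Qed.

(** The factor [d] is [-1] for upper bounds on [Q] and [1] for lower bounds. *)
Lemma slim_ge0 x y c d : d != 0 ->
  (exists N1, forall N, (N1 <= N)%N -> 0 <= d * inner (iota (a N) x) y + c) ->
  0 <= d * inner (Q x) y + c.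
Proof.
move=> d0 [N1 hN1]; apply: approx_ge0 => e e0.
pose k := normc d * (1 + rnorm y).
have d1 : 0 < normc d by rewrite lt_def normc_ge0 andbT; apply: contra_neq d0 => /ComplexField.Normc.eq0_normc.
have k0 : 0 < k by rewrite mulr_gt0// ltr_pwDl ?rnorm_ge0.
have [N0 hN0] := slim_inner x y (divr_gt0 e0 k0).
exists (d * inner (iota (a (maxn N0 N1)) x) y + c); first by apply: hN1; exact: leq_maxr.
rewrite [X in normc X](_ : _ = d * (inner (Q x) y - inner (iota (a (maxn N0 N1)) x) y)); last by ring.
rewrite ComplexField.Normc.normcM.
apply: (le_trans (ler_wpM2l (normc_ge0 _) (hN0 _ (leq_maxl _ _)))).
rewrite mulrCA mulrAC ler_pdivrMr// ler_wpM2l ?(ltW e0)// /k ler_wpM2l ?normc_ge0//.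
by rewrite lerDr.
Qed.

Lemma slim_const x y c : (exists N1, forall N, (N1 <= N)%N -> inner (iota (a N) x) y = c) ->
  inner (Q x) y = c.
Proof.
move=> [N1 h]; apply: (@normc_eps_eq _ _ _ (rnorm y)) => e e0 _.
have [N0 hN0] := slim_inner x y e0.
by rewrite mulrC -(h (maxn N0 N1)) ?leq_maxr// hN0 ?leq_maxl.
Qed.

(** Since [iota b] is bounded, the relation passes to the strong limit. It yields the idempotence of
    [Q]. *)
Lemma slim_mull b x : (exists N1, forall N, (N1 <= N)%N -> b ** a N = a N) ->
  iota b (Q x) = Q x.
Proof.
move=> [N1 h]; apply: (@rnorm_eps_eq _ _ _ _ (rnorm b + 1)) => e e0.
have [N0 hN0] := aQ x e0; pose N := maxn N0 N1.
have {}hN0 : rnorm (Q x - iota (a N) x) <= e by apply: hN0; exact: leq_maxl.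
rewrite -(subrKA (iota b (iota (a N) x))) -iotaBr -iotaM h ?leq_maxr//.
apply: (le_trans (rnormD _ _)); rewrite mulrDl mul1r; apply: lerD.
  by apply: (le_trans (hc _ _)); rewrite ler_wpM2l ?rnorm_ge0.
by rewrite rnormB.
Qed.

End StrongLimit.

Section DecreasingProjections.
Context (a : nat -> A).
Hypothesis pa : forall N, cs_proj (a N).
Hypothesis da : forall N M, (N <= M)%N -> a N ** a M = a M.

(** For [N <= M] the difference of the two projections is a projection, so the square of the norm of
    its value at [x] is [f N - f M]. As [f] is bounded below, the values at [x] form a Cauchy
    sequence. *)
Lemma slim_exists : exists Q, slim a Q.
Proof.
suff /choice[Q hQ] : forall x, exists l : H, forall e : R, 0 < e ->
    exists N0, forall N, (N0 <= N)%N -> rnorm (l - iota (a N) x) <= e by exists Q.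
move=> x; pose f N := rnorm (iota (a N) x) ^+ 2.
have fE N M : (N <= M)%N -> rnorm (iota (a N) x - iota (a M) x) ^+ 2 = f N - f M.
  move=> NM; apply: complexI; rewrite -iotaB -inner_proj; last exact: cs_projB (da NM).
  by rewrite iotaB innerBl !inner_proj// -rmorphB.
pose E := [set f N | N in setT].
have infE : has_inf E.
  split; first by exists (f 0%N), 0%N.
  by exists 0 => _ [N _ <-]; exact: sqr_ge0.
have cau (e : R) : 0 < e -> exists N0, forall N, (N0 <= N)%N ->
    rnorm (iota (a N0) x - iota (a N) x) < e.
  move=> e0; have e2 : 0 < e ^+ 2 by rewrite exprn_gt0.
  have [_ [N0 _ <-] hN0] := inf_adherent e2 infE.
  exists N0 => N NN; rewrite -(@ltr_pXn2r _ 2)// ?nnegrE ?rnorm_ge0 ?(ltW e0)// fE//.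
  have : inf E <= f N by apply: ge_inf; [case: infE | exists N].
  by lra.
have : cvg ((fun N => iota (a N) x) @ \oo).
  apply: cauchy_cvg; apply: cauchy_exP => -[e s]; rewrite ltcE /= => /andP[/eqP -> e0].
  have [N0 hN0] := cau e e0; exists (iota (a N0) x).
  exists N0 => // N /= NN; rewrite -ball_normE /ball_ /= rnormE.
  by rewrite -[e +i* 0]/(e%:C) ltcR hN0.
move=> /cvg_ex[l /cvgrPdist_lt hl]; exists l => e e0.
have [|N0 _ hN0] := hl e%:C; first by rewrite ltcR.
exists N0 => N NN; apply: ltW; rewrite -ltcR -rnormE; exact: hN0.
Qed.

Context (Q : H -> H) (aQ : slim a Q).

Let aQ2 x y (e : R) : 0 < e -> exists N,
  rnorm (Q x - iota (a N) x) <= e /\ rnorm (Q y - iota (a N) y) <= e.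
Proof.
move=> e0; have [N0 h0] := aQ x e0; have [N1 h1] := aQ y e0.
by exists (maxn N0 N1); rewrite h0 ?h1 ?leq_maxl ?leq_maxr.
Qed.

Let Q_linear : linear Q.
Proof.
move=> k x y; apply: (@rnorm_eps_eq _ _ _ _ (1 + (normc k + 1))) => e e0.
have [N0 h0] := aQ (k *: x + y) e0; have [N1 h1] := aQ x e0; have [N2 h2] := aQ y e0.
pose N := maxn N0 (maxn N1 N2).
have {}h0 := h0 N (leq_maxl _ _).
have {}h1 : rnorm (Q x - iota (a N) x) <= e.
  by apply: h1; rewrite (leq_trans (leq_maxl N1 N2)) ?leq_maxr.
have {}h2 : rnorm (Q y - iota (a N) y) <= e.
  by apply: h2; rewrite (leq_trans (leq_maxr N1 N2)) ?leq_maxr.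
rewrite -(subrKA (iota (a N) (k *: x + y))); apply: (le_trans (rnormD _ _)).
rewrite mulrDl mul1r; apply: lerD => //.
rewrite iota_lin opprD addrACA -scalerBr; apply: (le_trans (rnormD _ _)).
rewrite mulrDl mul1r rnormZ rnormB; apply: lerD; last by rewrite rnormB.
by rewrite ler_wpM2l ?normc_ge0.
Qed.

Let Q_le x : rnorm (Q x) <= rnorm x.
Proof.
apply/ler_addgt0Pr => e e0; have [N [hN _]] := aQ2 x x e0.
rewrite -[Q x](subrK (iota (a N) x)) addrC; apply: (le_trans (rnormD _ _)).
apply: lerD => //; apply: (le_trans (hc _ _)).
by rewrite ler_piMl ?rnorm_ge0 ?cs_proj_norm.
Qed.

Let Q_selfadjoint x y : inner (Q x) y = inner x (Q y).
Proof.
apply: (@normc_eps_eq _ _ _ (rnorm y + rnorm x)) => e e0 _.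
have [N [hx hy]] := aQ2 x y e0.
have -> : inner (Q x) y - inner x (Q y)
   = inner (Q x - iota (a N) x) y + - inner x (Q y - iota (a N) y).
  by rewrite innerBl innerBr -[X in iota X x](pa N).1 iota_star; ring.
apply: (le_trans (normcD _ _)); rewrite normcN mulrDl.
apply: lerD; apply: (le_trans (inner_CS _ _)); last by rewrite ler_wpM2l ?rnorm_ge0.
by rewrite mulrC ler_wpM2l ?rnorm_ge0.
Qed.

Let Q_idem x : Q (Q x) = Q x.
Proof.
apply: (@rnorm_eps_eq _ _ _ _ 1) => e e0; have [N0 h] := aQ (Q x) e0.
rewrite mul1r -[X in _ - X](@slim_mull _ _ aQ (a N0)); first exact: h.
by exists N0 => N; exact: da.
Qed.

Lemma slim_le N : op_le Q (iota (a N)).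
Proof.
move=> x; rewrite innerBl addrC -mulN1r; apply: (slim_ge0 aQ).
  by rewrite oppr_eq0 oner_eq0.
exists N => M NM; rewrite mulN1r addrC -innerBl.
exact: (iota_le_proj (pa M) (pa N) (da NM)).
Qed.

(** An operator of the commutant commutes with every [iota (a N)]; being bounded, it commutes with
    their strong limit. *)
Let Q_enveloping : enveloping_sa U Q.
Proof.
split; last exact: Q_selfadjoint.
split.
  split; first exact: Q_linear.
  by exists 1 => x; rewrite mul1r !rnormE lecR Q_le.
move=> T [[linT [M TM]] comm]; apply/funext => x /=.
(* The bound [M] is a complex number, known to be nonnegative only if some vector is nonzero; its
   modulus serves in all cases. *)
have TM' y : rnorm (T y) <= normc M * rnorm y.
  rewrite -lecR [leRHS]rmorphM /= -!rnormE -normcE.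
  have M0 : 0 <= M * `|y| by apply: le_trans (TM y).
  apply: (le_trans (TM y)).
  have [->|y0] := eqVneq `|y| 0; first by rewrite !mulr0.
  by rewrite ger0_norm// -(pmulr_lge0 _ (_ : 0 < `|y|))// lt_def y0 normr_ge0.
apply: (@rnorm_eps_eq _ _ _ _ (1 + normc M)) => e e0.
have [N [h1 h2]] := aQ2 (T x) x e0.
have cN : T (iota (a N) x) = iota (a N) (T x).
  have rN : range iota (iota (a N)) by exists (a N).
  exact: (congr1 (fun f => f x) (comm _ rN)).
rewrite -(subrKA (iota (a N) (T x))) mulrDl mul1r; apply: (le_trans (rnormD _ _)).
apply: lerD => //; rewrite -cN.
have -> : T (iota (a N) x) - T (Q x) = T (iota (a N) x - Q x).
  by have := linT (-1) (Q x) (iota (a N) x); rewrite !scaleN1r ![- _ + _]addrC => ->.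
apply: (le_trans (TM' _)); rewrite ler_wpM2l ?normc_ge0// rnormB.
exact: h2.
Qed.

Lemma slim_enveloping : enveloping_sa U Q. Proof. exact: Q_enveloping. Qed.

Lemma slim_idem x : Q (Q x) = Q x. Proof. exact: Q_idem. Qed.

(** Each [a N] belongs to [up U Q], and whatever lies below all of them lies below their strong
    limit. *)
Lemma slim_compact : compact_proj U Q.
Proof.
have up_a N : up U Q (a N) by split; [exact: cs_proj_pos | exact: slim_le].
split; [split|exists (a 0%N)|split] => //; first by apply/funext => x /=; exact: Q_idem.
  by move=> _ [b [_ hb] <-].
move=> z _ hz x; rewrite innerBl -[inner (Q x) x]mul1r; apply: (slim_ge0 aQ).
  exact: oner_neq0.
exists 0%N => N _; rewrite mul1r -innerBl; apply: hz; by exists (a N).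
Qed.

End DecreasingProjections.

Lemma slim_diff_le (a b : nat -> A) (P Q : H -> H) (d : R) :
  slim a P -> slim b Q -> (forall N, rnorm (a N - b N) <= d) ->
  forall x, rnorm (P x - Q x) <= d * rnorm x.
Proof.
move=> aP bQ ab x; apply/ler_addgt0Pr => e e0; have e2 : 0 < e / 2 by rewrite divr_gt0.
have [N0 h0] := aP x _ e2; have [N1 h1] := bQ x _ e2; pose N := maxn N0 N1.
have {}h0 := h0 N (leq_maxl _ _); have {}h1 := h1 N (leq_maxr _ _).
have t1 := rnormD (P x - iota (a N) x) (iota (a N) x - Q x).
have t2 := rnormD (iota (a N) x - iota (b N) x) (iota (b N) x - Q x).
rewrite subrKA in t1; rewrite subrKA -iotaB [rnorm (iota (b N) x - _)]rnormB in t2.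
have t3 := le_trans (hc (a N - b N) x) (ler_wpM2r (rnorm_ge0 x) (ab N)).
apply: (le_trans t1); apply: (le_trans (lerD h0 t2)).
apply: (le_trans (lerD (lexx _) (lerD t3 h1))).
by rewrite [X in _ <= _ + X]splitr addrCA.
Qed.

End Representations.

(** * The example *)

Section TwoByTwo.
Context {R : realType}.
Local Notation C := R[i].
Implicit Types (t : R) (x : 'rV[C]_2).

Let vcoef t (i : 'I_2) : R := if i == 0 then 1 else t.

(* The orthogonal projection onto the line spanned by [(1, t)]. *)
Definition line_proj t : 'M[C]_2 :=
  \matrix_(i, j) ((1 + t ^+ 2)^-1 * vcoef t i * vcoef t j)%:C.

(** The vector [(-t, 1)], orthogonal to the line of [(1, t)]. *)
Definition line_orth t : 'rV[C]_2 := \row_j (if j == 0 then - t else 1)%:C.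

Let den_neq0 t : 1 + t ^+ 2 != 0.
Proof. by rewrite gt_eqF// ltr_pwDl ?sqr_ge0. Qed.

Lemma line_proj_adj t : adjmx (line_proj t) = line_proj t.
Proof. by apply/matrixP => i j; rewrite !mxE conj_realC mulrAC. Qed.

Lemma line_proj_idem t : line_proj t *m line_proj t = line_proj t.
Proof.
apply/matrixP => i j; rewrite !mxE !big_ord_recr big_ord0 /= add0r !mxE.
rewrite -!rmorphM -rmorphD; congr (_%:C); rewrite /vcoef /=.
by have := den_neq0 t; case: (i == 0); case: (j == 0) => h; field.
Qed.

Lemma line_orth_proj t : line_orth t *m line_proj t = 0.
Proof.
apply/matrixP => i j; rewrite !mxE !big_ord_recr big_ord0 /= add0r !mxE.
by rewrite -!rmorphM -rmorphD -(rmorph0 (real_complex R)); congr (_%:C); rewrite /vcoef /=; ring.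
Qed.

Definition e1 : 'rV[C]_2 := delta_mx 0 0.

Lemma form_e1 x : ph_form (x : rows 2) e1 = x 0 0.
Proof.
rewrite /ph_form /= /rdot (bigD1 0)//= big1 => [|j /negPf j0].
  by rewrite mxE eqxx conjC1 mulr1 addr0.
by rewrite mxE j0 andbF conjC0 mulr0.
Qed.

Lemma snorm_e1 : snorm (e1 : rows 2) = 1.
Proof. by rewrite /snorm form_e1 mxE eqxx /= sqrtr1. Qed.

(** For nonzero [t], a matrix that annihilates the vectors orthogonal to both lines therefore
    annihilates [e1]. *)
Lemma e1_line_orth t : (2 * t)%:C *: e1 = line_orth (- t) - line_orth t.
Proof.
apply/matrixP => i j; rewrite !mxE (ord1 i) eqxx /=; case: j => [[|[|//]] h] /=.
  by rewrite mulr1 -rmorphB; congr (_%:C); ring.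
by rewrite mulr0 subrr.
Qed.

Lemma form_e1_line_proj t :
  ph_form (e1 *m line_proj t : rows 2) e1 = ((1 + t ^+ 2)^-1)%:C.
Proof.
by rewrite form_e1 -rowE !mxE /vcoef /= !mulr1.
Qed.

Lemma mul_line_proj0 x : x *m line_proj 0 = ph_form (x : rows 2) e1 *: e1.
Proof.
apply/matrixP => i j; rewrite (ord1 i) form_e1 !mxE !big_ord_recr !big_ord0 /= add0r.
rewrite !mxE /vcoef /= expr0n /= addr0 invr1.
have c0 : (0 : R)%:C = 0 by []; have c1 : (1 : R)%:C = 1 by [].
case: j => [[|[|//]] h] /=; rewrite ?mulr1 ?mulr0 ?mul0r ?mulr1 ?c0 ?c1 ?mulr0 ?addr0//.
by congr (x 0 _); exact: val_inj.
Qed.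

Lemma e1_line_proj0 : e1 *m line_proj 0 = e1.
Proof. by rewrite mul_line_proj0 snormE snorm_e1 expr1n scale1r. Qed.

(** As [line_proj 0] has rank one, a single vector controls the norm, here and in the next lemma. *)
Lemma opb_mul_line_proj0 (a : 'M[C]_2) (M : R) :
  snorm (e1 *m adjmx a : rows 2) <= M -> opb (a *m line_proj 0) M.
Proof.
move=> aM x; rewrite mulmxA mul_line_proj0 (@snormZ _ (rows 2)) snorm_e1 mulr1.
rewrite rdot_adj; apply: (le_trans (ph_CauchySchwarz _ _)).
by rewrite mulrC ler_wpM2r ?snorm_ge0.
Qed.

Lemma opb_line_proj0_mul (a : 'M[C]_2) (M : R) :
  snorm (e1 *m a : rows 2) <= M -> opb (line_proj 0 *m a) M.
Proof.
move=> aM x; rewrite mulmxA mul_line_proj0 -scalemxAl (@snormZ _ (rows 2)).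
apply: (@le_trans _ _ (snorm (x : rows 2) * snorm (e1 *m a : rows 2))).
  rewrite ler_wpM2r ?snorm_ge0//; apply: (le_trans (ph_CauchySchwarz _ _)).
  by rewrite snorm_e1 mulr1.
by rewrite mulrC ler_wpM2r ?snorm_ge0.
Qed.

Lemma line_proj0_compl : 1%:M - line_proj 0 = (line_orth 0)^T *m line_orth 0.
Proof.
have natC (b : bool) : (b%:R : C) = (b%:R)%:C by case: b.
apply/matrixP => i j; rewrite !mxE big_ord_recr big_ord0 /= add0r !mxE.
rewrite natC -rmorphM -rmorphB; congr (_%:C); rewrite /vcoef expr0n /= addr0 invr1 mul1r.
by case: i => [[|[|//]] hi]; case: j => [[|[|//]] hj] /=; ring.
Qed.

(** The difference is self-adjoint and its square is the scalar [t^2 / (1 + t^2)], the squared sine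
    of the angle between the lines. *)
Lemma opb_line_projB t : opb (line_proj 0 - line_proj t) `|t|.
Proof.
pose m := line_proj 0 - line_proj t.
have ma : adjmx m = m by rewrite adjmxB !line_proj_adj.
have mm : m *m m = (t ^+ 2 / (1 + t ^+ 2))%:C%:M.
  apply/matrixP => i j; rewrite !mxE !big_ord_recr big_ord0 /= add0r !mxE.
  rewrite -!rmorphB -!rmorphM -rmorphD -rmorphMn; congr (_%:C); rewrite /vcoef expr0n /= addr0 invr1.
  have := den_neq0 t.
  by case: i => [[|[|//]] hi]; case: j => [[|[|//]] hj] /= h; rewrite ?mulr1n ?mulr0n; field.
move=> x; rewrite -(@ler_pXn2r _ 2)// ?nnegrE ?mulr_ge0 ?snorm_ge0// exprMn real_normK ?num_real//.
rewrite snorm_sqr rdot_adj ma -mulmxA mm mul_mx_scalar (@ph_formZr _ (rows 2)) snormE.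
rewrite conj_realC -rmorphM /= ler_wpM2r ?sqr_ge0//.
rewrite ler_pdivrMr ?ltr_pwDl ?sqr_ge0// mulrDr mulr1 lerDl mulr_ge0 ?sqr_ge0//.
Qed.

Lemma rows_snorm_eq0 n (x : 'rV[C]_n) : snorm (x : rows n) = 0 -> x = 0.
Proof.
move=> x0; have := @snormE _ (rows n) x; rewrite x0 expr0n /= => /eqP.
rewrite /ph_form /= /rdot psumr_eq0 => [/allP h|j _]; last exact: mul_conjC_ge0.
apply/matrixP => i j; rewrite (ord1 i) mxE.
by have := h j (mem_index_enum _); rewrite /= mul_conjC_eq0 => /eqP.
Qed.

End TwoByTwo.

(** * The index set of the example and the projections of its algebra *)

Definition site : Type := option (nat * nat).

(* [None] is the point at infinity, the limit of [Some (k, n)] as [k] grows. *)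
Definition site_filter : set_system (site * site) :=
  [set S | (forall k, exists N, forall n, (N <= n)%N -> S (Some (k, n), Some (k, n.+1)))
           /\ exists K, forall k n, (K <= k)%N -> S (Some (k, n), None)].

Lemma site_filterF : Filter site_filter.
Proof.
split.
- by split=> [k|]; exists 0%N.
- move=> S T [S1 [K SK]] [T1 [L TL]]; split.
    move=> k; have [N hN] := S1 k; have [M hM] := T1 k.
    by exists (maxn N M) => n; rewrite geq_max => /andP[/hN ? /hM].
  by exists (maxn K L) => k n; rewrite geq_max => /andP[/(SK k n) ? /(TL k n)].
move=> S T ST [S1 [K SK]]; split.
  by move=> k; have [N hN] := S1 k; exists N => n /hN /ST.
by exists K => k n /(SK k n) /ST.
Qed.

Section Example.
Context {R : realType}.
Local Notation C := R[i].
Local Notation A := (@mf_algebra R 2 site site_filter site_filterF).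
Local Notation "a ** b" := (cs_mul a b) (at level 40, left associativity).
Local Notation L := (@line_proj R).
Local Notation row2 := (@rows R 2).
Local Notation ee := (@e1 R).

Definition mx_proj (p : 'M[C]_2) := adjmx p = p /\ p *m p = p.

Lemma mx_projL t : mx_proj (L t).
Proof. by split; [exact: line_proj_adj | exact: line_proj_idem]. Qed.

Lemma mx_proj1 : mx_proj 1%:M.
Proof. by split; [exact: adjmx1 | exact: mulmx1]. Qed.

Lemma mx_proj0 : mx_proj 0.
Proof. by split; [apply/matrixP => i j; rewrite !mxE conjC0 | rewrite mulmx0]. Qed.

Lemma cs_proj_mval (a : A) : (forall i, mx_proj (mval a i)) -> cs_proj a.
Proof. by move=> pa; split; apply: mvalP => i; rewrite ?mval_star ?mvalM; case: (pa i). Qed.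

Let opb_refl (m : 'M[C]_2) (e : R) : 0 < e -> opb (m - m) e.
Proof. by move=> e0; rewrite subrr; apply: opb_le opb0; exact: ltW. Qed.

(** For such eventually constant functions the differences in the continuity condition are
    eventually zero. *)
Let mval_proj_ex (m : site -> 'M[C]_2) : (forall i, mx_proj (m i)) ->
  (forall k, exists N, forall n, (N <= n)%N -> m (Some (k, n)) = m (Some (k, n.+1))) ->
  (exists K, forall k n, (K <= k)%N -> m (Some (k, n)) = m None) ->
  exists a : A, mval a = m.
Proof.
move=> pm m1 m2; apply: (@mval_ex _ _ _ _ _ _ 1) => // [i|e e0].
  by apply: opb_proj; case: (pm i).
split=> [k|].
  by have [N hN] := m1 k; exists N => n /hN /= ->; exact: opb_refl.
by have [K hK] := m2; exists K => k n /hK /= ->; exact: opb_refl.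
Qed.

Lemma const_ex (p : 'M[C]_2) : mx_proj p -> exists a : A, mval a = fun=> p.
Proof. by move=> pp; apply: mval_proj_ex => // [k|]; exists 0%N. Qed.

(* As [N] grows, these decrease to the largest projection of the enveloping
   algebra with value [m k n] at [(k, n)]. *)
Definition trunc_mx (m : nat -> nat -> 'M[C]_2) N : site -> 'M[C]_2 := fun i =>
  if i is Some (k, n) then if (k <= N)%N && (n <= N)%N then m k n else 1%:M else 1%:M.

Lemma trunc_proj m N i : (forall k n, mx_proj (m k n)) -> mx_proj (trunc_mx m N i).
Proof. by move=> pm; case: i => [[k n]|] /=; [case: ifP => _ //|]; exact: mx_proj1. Qed.

(** Outside a finite square the value is the identity, so an oscillation of [m] along the rows does
    not prevent membership in the algebra. *)
Lemma trunc_ex m : (forall k n, mx_proj (m k n)) ->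
  exists a : nat -> A, forall N, mval (a N) = trunc_mx m N.
Proof.
move=> pm; suff /choice[a ha] : forall N, exists a : A, mval a = trunc_mx m N by exists a.
move=> N; apply: mval_proj_ex => [i|k|]; first exact: trunc_proj.
  exists N.+1 => n Nn /=; rewrite !(leqNgt n) !(leqNgt n.+1) Nn ltnS (ltnW Nn) /=.
  by rewrite !andbF.
by exists N.+1 => k n Nk /=; rewrite leqNgt Nk.
Qed.

Lemma trunc_mul m N M i : (forall k n, mx_proj (m k n)) -> (N <= M)%N ->
  trunc_mx m N i *m trunc_mx m M i = trunc_mx m M i.
Proof.
move=> pm NM; case: i => [[k n]|] /=; last by rewrite mulmx1.
case: ifP => [/andP[kN nN]|_]; last by rewrite mul1mx.
by rewrite (leq_trans kN NM) (leq_trans nN NM) /=; case: (pm k n).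
Qed.

Definition tail_mx N : site -> 'M[C]_2 := fun i =>
  if i is Some (k, n) then if (N <= k)%N then L 0 else 0 else L 0.

Lemma tail_proj N i : mx_proj (tail_mx N i).
Proof.
by case: i => [[k n]|] /=; [case: ifP => _|]; (exact: mx_projL || exact: mx_proj0).
Qed.

Lemma tail_ex : exists a : nat -> A, forall N, mval (a N) = tail_mx N.
Proof.
suff /choice[a ha] : forall N, exists a : A, mval a = tail_mx N by exists a.
move=> N; apply: mval_proj_ex => [i|k|]; first exact: tail_proj.
  by exists 0%N.
by exists N => k n Nk /=; rewrite Nk.
Qed.

Lemma tail_mul N M i : (N <= M)%N -> tail_mx N i *m tail_mx M i = tail_mx M i.
Proof.
move=> NM; case: i => [[k n]|] /=; last by case: (mx_projL 0).
case: (leqP M k) => [Mk|]; last by rewrite mulmx0.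
by rewrite (leq_trans NM Mk); case: (mx_projL 0).
Qed.

(** By scaling; vector states only test unit vectors. *)
Lemma form_ge0_unit (m : 'M[C]_2) :
  (forall x : row2, snorm x = 1 -> 0 <= ph_form (x *m m : row2) x) ->
  forall x : row2, 0 <= ph_form (x *m m : row2) x.
Proof.
move=> h x; have [x0|x0] := eqVneq (snorm x) 0.
  have -> : x = 0 by exact: rows_snorm_eq0.
  by rewrite mul0mx ph_form0l.
pose y : row2 := (snorm x)^-1%:C *: x.
have := h y; rewrite snormZ normc_real ger0_norm ?invr_ge0 ?snorm_ge0// mulVf// => /(_ erefl).
rewrite /y -scalemxAl ph_formZl ph_formZr mulrA -normCK pmulr_rge0//.
by rewrite exprn_gt0// normr_gt0 (_ : 0 = (0 : R)%:C)// (inj_eq (@complexI _)) invr_eq0.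
Qed.

Lemma pos_ball_mx (a : A) : pos_ball a -> exists2 c : A, rnorm c <= 1 &
  forall i, mval a i = adjmx (mval c i) *m mval c i.
Proof.
move=> [[c ac] a1]; exists c; last by move=> i; rewrite ac mvalM mval_star.
rewrite -(@ler_pXn2r _ 2)// ?nnegrE ?rnorm_ge0// -cs_rnorm_star_mul -ac expr1n.
by rewrite -lecR -rnormE.
Qed.

Lemma pos_ball_adj (a : A) i : pos_ball a -> adjmx (mval a i) = mval a i.
Proof. by move=> /pos_ball_mx[c _ ->]; rewrite adjmxM adjmxK. Qed.

(** Writing the value of [a] as [adjmx c *m c], the form in the hypothesis is minus the square of
    the norm of [x *m adjmx c], which must then vanish. *)
Lemma pos_ball_kernel (a : A) i (m : 'M[C]_2) (x : row2) : pos_ball a ->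
  0 <= ph_form (x *m (m - mval a i) : row2) x -> x *m m = 0 -> x *m mval a i = 0.
Proof.
move=> /pos_ball_mx[c _ ->] + xm; rewrite mulmxBr xm sub0r -scaleN1r ph_formZl mulN1r.
rewrite mulmxA rdot_adj snormE -rmorphN ler0c oppr_ge0 => h.
have /rows_snorm_eq0 -> : snorm (x *m adjmx (mval c i) : row2) = 0.
  by apply/eqP; rewrite -sqrf_eq0 eq_le h sqr_ge0.
by rewrite mul0mx.
Qed.

(** This is the inequality [a^2 <= a] for positive contractions. *)
Lemma pos_ball_sqr (a : A) i (x : row2) : pos_ball a ->
  snorm (x *m mval a i : row2) ^+ 2 <= complex.Re (ph_form (x *m mval a i : row2) x).
Proof.
move=> /pos_ball_mx[c c1 ->]; rewrite mulmxA [in leRHS]rdot_adj -snorm_sqr.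
rewrite ler_pXn2r ?nnegrE ?snorm_ge0//; apply: (le_trans (mval_opb c i _)).
by rewrite ler_piMl ?snorm_ge0.
Qed.

(** * The limit projections, tested on vector states *)

Section Rep.
Context (U : universalRep A).
Local Notation H := (ur_space U).
Local Notation iota := (@ur_rep R A U).
Local Notation inner := (hs_inner H).
Hypothesis hc : forall a x, rnorm (iota a x) <= rnorm a * rnorm x.
Hypothesis hone : forall u, is_unit u -> forall x, iota u x = x.

Definition vvec i (x : row2) : H :=
  ur_vec U (fun a : A => ph_form (x *m mval a i : row2) x).

Lemma vvec_state i (x : row2) a : snorm x = 1 ->
  inner (iota a (vvec i x)) (vvec i x) = ph_form (x *m mval a i : row2) x.
Proof. by move=> x1; rewrite ur_state//; exact: vector_state. Qed.

Lemma one_unit (u : A) : mval u = (fun=> 1%:M) -> is_unit u.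
Proof. by move=> u1 a; split; apply: mvalP => i; rewrite mvalM u1 ?mul1mx ?mulmx1. Qed.

Lemma vvec_norm i (x : row2) : snorm x = 1 -> rnorm (vvec i x) = 1.
Proof.
move=> x1; have [u hu] := const_ex mx_proj1.
have := vvec_state i u x1; rewrite hone; last exact: one_unit.
rewrite hu mulmx1 snormE x1 inner_sqr => /complexI/eqP.
by rewrite eqrXn2 ?rnorm_ge0// => /eqP.
Qed.

Section Truncations.
Context (m : nat -> nat -> 'M[C]_2) (pm : forall k n, mx_proj (m k n)).
Context (a : nat -> A) (am : forall N, mval (a N) = trunc_mx m N).

Lemma trunc_cs_proj N : cs_proj (a N).
Proof. by apply: cs_proj_mval => i; rewrite am; exact: trunc_proj. Qed.

Lemma trunc_decr N M : (N <= M)%N -> a N ** a M = a M.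
Proof. by move=> NM; apply: mvalP => i; rewrite mvalM !am trunc_mul. Qed.

Context (Q : H -> H) (aQ : @slim R A U a Q).

Lemma trunc_compact : compact_proj U Q.
Proof. exact: (slim_compact hc trunc_cs_proj trunc_decr aQ). Qed.

Definition trunc_lim : site -> 'M[C]_2 := fun i => if i is Some (k, n) then m k n else 1%:M.

(** Once [N] is at least [k] and [n], the vector state at [(k, n)] sees the constant value [m k n];
    at infinity every truncation is the identity. *)
Lemma trunc_lim_inner i (x : row2) : snorm x = 1 ->
  inner (Q (vvec i x)) (vvec i x) = ph_form (x *m trunc_lim i : row2) x.
Proof.
move=> x1; apply: (slim_const aQ).
exists (if i is Some (k, n) then maxn k n else 0%N) => N hN.
rewrite vvec_state// am; case: i hN => [[k n]|]//=.
by rewrite geq_max => ->.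
Qed.

Lemma down_trunc (b : A) i (x : row2) : op_le (iota b) Q ->
  0 <= ph_form (x *m (trunc_lim i - mval b i) : row2) x.
Proof.
move=> bQ; move: x; apply: form_ge0_unit => x x1.
have := bQ (vvec i x); rewrite innerBl trunc_lim_inner// vvec_state//.
by rewrite mulmxBr -(@ph_formBl _ row2).
Qed.

Lemma up_trunc (b : A) i (x : row2) : op_le Q (iota b) ->
  0 <= ph_form (x *m (mval b i - trunc_lim i) : row2) x.
Proof.
move=> bQ; move: x; apply: form_ge0_unit => x x1.
have := bQ (vvec i x); rewrite innerBl trunc_lim_inner// vvec_state//.
by rewrite mulmxBr -(@ph_formBl _ row2).
Qed.

End Truncations.

(** From [a = a z] follows [a = z a z], which is at most [z] because [a] is a positive
    contraction. *)
Lemma compress_le (z : H -> H) (a : A) : enveloping_sa U z -> (forall x, z (z x) = z x) ->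
  pos_ball a -> (forall x, iota a x = iota a (z x)) -> op_le (iota a) z.
Proof.
move=> [_ saz] zz [[c ac] a1] az x.
have c1 : rnorm c <= 1.
  rewrite -(@ler_pXn2r _ 2)// ?nnegrE ?rnorm_ge0// -cs_rnorm_star_mul -ac expr1n.
  by rewrite -lecR -rnormE.
have E : inner (iota a x) x = (rnorm (iota c (z x)) ^+ 2)%:C.
  rewrite az ac iotaM iota_star -inner_sqr inner_herm -[in LHS]iota_star -iotaM -ac.
  by rewrite az ac iotaM iota_star -inner_herm.
rewrite innerBl E -(zz x) saz inner_sqr -rmorphB ler0c subr_ge0.
rewrite zz ler_pXn2r ?nnegrE ?rnorm_ge0//; apply: (le_trans (hc _ _)).
by rewrite ler_piMl ?rnorm_ge0.
Qed.

(** * The projection [p] and its complement *)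

Section Tail.
Context (b : nat -> A) (bm : forall N, mval (b N) = tail_mx N).
Context (p : H -> H) (bp : @slim R A U b p).

Lemma tail_cs_proj N : cs_proj (b N).
Proof. by apply: cs_proj_mval => i; rewrite bm; exact: tail_proj. Qed.

Lemma tail_decr N M : (N <= M)%N -> b N ** b M = b M.
Proof. by move=> NM; apply: mvalP => i; rewrite mvalM !bm tail_mul. Qed.

Lemma tail_compact : compact_proj U p.
Proof. exact: (slim_compact hc tail_cs_proj tail_decr bp). Qed.

Lemma tail_sa : enveloping_sa U p.
Proof. exact: (slim_enveloping hc tail_cs_proj bp). Qed.

Lemma tail_idem x : p (p x) = p x.
Proof. exact: (slim_idem hc tail_decr bp). Qed.

Let xi := vvec None ee.

Let p_xi_inner : inner (p xi) xi = 1.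
Proof.
apply: (slim_const bp); exists 0%N => N _.
by rewrite vvec_state ?snorm_e1// bm -[tail_mx N None]/(L 0) e1_line_proj0 snormE snorm_e1 expr1n.
Qed.

Let xi_inner : inner xi xi = 1.
Proof. by rewrite inner_sqr vvec_norm ?snorm_e1// expr1n. Qed.

(** The unit vector [xi] belongs to the state of [e1] at infinity, where every [b N] is
    [line_proj 0]. So the form of [p xi] and [xi] is [1], which forces [xi] into the range of
    [p]. *)
Lemma tail_xi : p xi = xi.
Proof.
apply/eqP; rewrite -subr_eq0; apply/eqP/rnorm0_eq0/eqP; rewrite -sqrf_eq0; apply/eqP.
apply: complexI; rewrite -inner_sqr innerBl !innerBr.
rewrite [inner xi (p xi)]inner_herm p_xi_inner xi_inner.
have [_ sap] := tail_sa.
by rewrite sap tail_idem [inner xi _]inner_herm p_xi_inner conjC1 !subrr.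
Qed.

Definition cotail (x : H) : H := x - p x.

Lemma cotail_idem x : cotail (cotail x) = cotail x.
Proof.
rewrite /cotail; have [[[linp _] _] _] := tail_sa.
have -> : p (x - p x) = p x - p (p x).
  by have := linp (-1) (p x) x; rewrite !scaleN1r ![- _ + _]addrC.
by rewrite tail_idem subrr subr0.
Qed.

Lemma cotail_sa : enveloping_sa U cotail.
Proof.
have [[[linp [M pM]] comm] sap] := tail_sa.
split; last by move=> x y; rewrite innerBl innerBr sap.
split.
  split; first by move=> k x y; rewrite /cotail linp scalerBr opprD addrACA.
  exists (1 + M) => x; rewrite mulrDl mul1r; apply: (le_trans (ler_normB _ _)).
  by rewrite lerD2l.
move=> T hT; have [[linT _] _] := hT; apply/funext => x; rewrite /= /cotail.
have -> : T (x - p x) = T x - T (p x).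
  by have := linT (-1) (p x) x; rewrite !scaleN1r ![- _ + _]addrC.
by congr (_ - _); exact: (congr1 (fun f => f x) (comm _ hT)).
Qed.

(* If [a e1] vanishes at infinity, then [a b_N] tends to [0] in norm, whence
   [a p = 0]. *)
Lemma tail_orthogonal (a : A) : pos_ball a -> snorm (ee *m mval a None : row2) = 0 ->
  op_le (iota a) cotail.
Proof.
move=> pa a0.
have small (e : R) : 0 < e -> exists N0, forall N, (N0 <= N)%N -> rnorm (a ** b N) <= e.
  move=> e0; have [_ [K hK]] := mval_ucont a e0; exists K => N KN.
  apply: mval_norm_le; first exact: ltW.
  move=> i; rewrite mvalM bm.
  have nz j : (forall k n, j = Some (k, n) -> (K <= k)%N) -> opb (mval a j *m L 0) e.
    move=> hj; apply: opb_mul_line_proj0; rewrite pos_ball_adj//.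
    case: j hj => [[k n]|] hj; last by rewrite a0 ltW.
    rewrite -[mval a _](subrK (mval a None)) mulmxDr; apply: (le_trans (snormD _ _)).
    by rewrite a0 addr0; have /= := hK k n (hj k n erefl) ee; rewrite snorm_e1 mulr1.
  case: i => [[k n]|] /=; last by apply: nz.
  case: leqP => Nk; first by apply: nz => k' n' [<- _]; exact: leq_trans Nk.
  by rewrite mulmx0; apply: opb_le opb0; exact: ltW.
have ap x : iota a (p x) = 0.
  apply: (@rnorm_eps_eq _ _ _ _ (rnorm a + rnorm x)) => e e0; rewrite subr0.
  have [N0 h0] := small e e0; have [N1 h1] := bp x e0; pose N := maxn N0 N1.
  have {}h0 := h0 N (leq_maxl _ _); have {}h1 := h1 N (leq_maxr _ _).
  rewrite -[p x](subrK (iota (b N) x)).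
  have -> : iota a (p x - iota (b N) x + iota (b N) x)
     = iota a (p x - iota (b N) x) + iota (a ** b N) x.
    by rewrite iotaM !iotaBr subrK subrK.
  apply: (le_trans (rnormD _ _)); rewrite mulrDl; apply: lerD.
    by apply: (le_trans (hc _ _)); rewrite ler_wpM2l ?rnorm_ge0.
  by apply: (le_trans (hc _ _)); rewrite mulrC ler_wpM2l ?rnorm_ge0.
apply: compress_le => //; [exact: cotail_sa | exact: cotail_idem |].
by move=> x; rewrite /cotail iotaBr ap subr0.
Qed.

End Tail.

Definition tilt k n : R := (-1) ^+ n * k.+1%:R^-1.

Lemma tiltS k n : tilt k n.+1 = - tilt k n :> R.
Proof. by rewrite /tilt exprS mulN1r mulNr. Qed.

Lemma norm_tilt k n : `|tilt k n| = k.+1%:R^-1 :> R.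
Proof. by rewrite /tilt normrM normrX normrN1 expr1n mul1r ger0_norm. Qed.

Definition tilted K k n : 'M[C]_2 := L (tilt (k + K) n).

Lemma tilted_proj K k n : mx_proj (tilted K k n).
Proof. exact: mx_projL. Qed.

(** * Positive elements below and above the tilted projections *)

Section Tilted.
Context (K : nat) (a : nat -> A) (am : forall N, mval (a N) = trunc_mx (tilted K) N).
Context (Q : H -> H) (aQ : @slim R A U a Q).

(* Along each row, [tilted] alternates between two distinct lines, while the
   variation of [b] vanishes at the end of the row. *)
Lemma down_tilted (b : A) : pos_ball b -> op_le (iota b) Q ->
  snorm (ee *m mval b None : row2) = 0.
Proof.
move=> pb bQ.
have ker k n : line_orth (tilt (k + K) n) *m mval b (Some (k, n)) = 0.
  apply: (@pos_ball_kernel b (Some (k, n)) (tilted K k n)) => //; last exact: line_orth_proj.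
  have := down_trunc am aQ (Some (k, n)) (line_orth (tilt (k + K) n)) bQ.
  exact.
have e1_small k (e : R) : 0 < e ->
    exists n, snorm (ee *m mval b (Some (k, n)) : row2) <= e.
  move=> e0; pose t n := tilt (k + K) n : R.
  have t0 n : 0 < `|2 * t n| by rewrite normrM norm_tilt mulr_gt0 ?invr_gt0// normr_gt0 pnatr_eq0.
  pose c n : R := snorm (line_orth (- t n) : row2) + 1.
  have c0 n : 0 < c n by rewrite ltr_wpDl ?snorm_ge0.
  (* The denominator exceeds the norms of [line_orth (- t n)] for both parities of [n]; the factor
     [2 / (k + K + 1)] is the modulus of [2 * t n]. *)
  pose d : R := e * (2 * (k + K).+1%:R^-1) / (c 0%N + c 1%N).
  have d0 : 0 < d by rewrite divr_gt0 ?(addr_gt0 (c0 _) (c0 _)) ?mulr_gt0 ?invr_gt0.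
  have [+ _] := mval_ucont b d0 => /(_ k)[N hN].
  pose n := N.*2; have n_ge : (N <= n)%N by rewrite /n -addnn leq_addr.
  (* This vector is annihilated at [n.+1]. At [n] it differs by [2 * t n] times [e1] from a vector
     annihilated there. *)
  exists n; have /= := hN n n_ge (line_orth (- t n)).
  rewrite mulmxBr -[- t n]tiltS ker subr0.
  have tn : t n = t 0%N by rewrite /t /tilt -[in LHS]signr_odd odd_double.
  have -> : line_orth (t n.+1) *m mval b (Some (k, n)) = (2 * t n)%:C *: (ee *m mval b (Some (k, n))).
    by rewrite scalemxAl e1_line_orth mulmxBl ker subr0 /t tiltS.
  rewrite (@snormZ _ row2) normc_real mulrC -ler_pdivlMr// => /le_trans; apply.
  rewrite ler_pdivrMr// normrM norm_tilt ger0_norm// /d mulrAC ler_pdivrMr ?(addr_gt0 (c0 _) (c0 _))//.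
  rewrite ler_wpM2l ?mulr_ge0 ?(ltW e0)//.
  have -> : tilt (k + K) n.+1 = - t 0%N by rewrite tiltS -[tilt _ n]/(t n) tn.
  by rewrite [X in X + _]/c -addrA lerDl addr_ge0 ?ltW.
apply: (@snorm_eq0_of_le _ row2) => e e0; have e2 : 0 < e / 2 by rewrite divr_gt0.
have [_ [k hk]] := mval_ucont b e2; have [n hn] := e1_small k _ e2.
rewrite -[mval b None](subrK (mval b (Some (k, n)))) mulmxDr.
apply: (le_trans (snormD _ _)); rewrite [e]splitr; apply: lerD => //.
have := hk k n (leqnn _) ee; rewrite snorm_e1 mulr1 /=; apply: le_trans.
by rewrite -opprB mulmxN -scaleN1r (@snormZ _ row2) normcN ComplexField.Normc.normc1 mul1r.
Qed.

(** With [s] the form of [e1 m] and [e1], expanding the square and using [m^2 <= m] bounds it by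
    [1 - s]. Since [s] is at least [1 / (1 + t^2)], this is at most [t^2]. *)
Lemma up_tilted (b : A) k n : pos_ball b -> op_le Q (iota b) ->
  snorm (ee *m (1%:M - mval b (Some (k, n))) : row2) <= (k + K).+1%:R^-1.
Proof.
move=> pb Qb; set m := mval b _.
have s0 : 0 <= (k + K).+1%:R^-1 :> R by rewrite invr_ge0.
rewrite -(@ler_pXn2r _ 2)// ?nnegrE ?snorm_ge0//.
have h1 : 0 <= ph_form (ee *m m : row2) ee - ((1 + tilt (k + K) n ^+ 2)^-1)%:C.
  have := up_trunc am aQ (Some (k, n)) ee Qb.
  by rewrite mulmxBr (@ph_formBl _ row2) -form_e1_line_proj.
have {}h1 := (ge0_Re h1).2.
have h2 : snorm (ee *m m : row2) ^+ 2 <= complex.Re (ph_form (ee *m m : row2) ee).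
  exact: pos_ball_sqr.
have h3 : complex.Re (ph_form (ee : row2) (ee *m m)) = complex.Re (ph_form (ee *m m : row2) ee).
  by rewrite [in LHS]ph_herm; case: (ph_form _ _).
rewrite mulmxBr mulmx1 (@snormB_sqr _ row2) snorm_e1 h3 expr1n.
move: h1 h2; rewrite -[_ ^-1 ^+ 2](@real_normK _ _ (num_real _)).
have -> : `|(k + K).+1%:R^-1| = `|tilt (k + K) n| :> R by rewrite norm_tilt ger0_norm.
rewrite real_normK ?num_real//; move: (tilt _ _) => t.
have p0 : 0 < 1 + t ^+ 2 by rewrite ltr_pwDl ?sqr_ge0.
have : 1 - (1 + t ^+ 2)^-1 <= t ^+ 2.
  rewrite -[X in X - _](mulfV (lt0r_neq0 p0)) -[X in _ - X]mul1r -mulrBl.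
  by rewrite ler_pdivrMr// addrAC subrr add0r ler_peMr ?sqr_ge0// lerDl sqr_ge0.
case: (ph_form _ _) => x y /=; lra.
Qed.

End Tilted.

(** * The interior of the flat projection [r] *)

Section Flat.
Context (a : nat -> A) (am : forall N, mval (a N) = trunc_mx (fun _ _ => L 0) N).
Context (r : H -> H) (ar : @slim R A U a r).
Context (c : A) (cE : mval c = fun=> L 0).

Lemma const_cs_proj : cs_proj c.
Proof. by apply: cs_proj_mval => i; rewrite cE; exact: mx_projL. Qed.

(** At infinity [trunc_lim] is the identity and gives no constraint; there the kernel condition is
    obtained from the finite sites by continuity. *)
Lemma down_flat (b : A) : pos_ball b -> op_le (iota b) r -> b ** c = b.
Proof.
move=> pb br.
have ker i : line_orth 0 *m mval b i = 0.
  have ker k n : line_orth 0 *m mval b (Some (k, n)) = 0.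
    apply: (@pos_ball_kernel b (Some (k, n)) (L 0)) => //; last exact: line_orth_proj.
    by have := down_trunc am ar (Some (k, n)) (line_orth 0) br; exact.
  case: i => [[k n]//|]; apply: rows_snorm_eq0; apply: (@snorm_eq0_of_le _ row2) => e e0.
  pose s := snorm (line_orth 0 : row2) + 1.
  have s0 : 0 < s by rewrite ltr_wpDl ?snorm_ge0.
  have [_ [k hk]] := mval_ucont b (divr_gt0 e0 s0).
  have := hk k 0%N (leqnn _) (line_orth 0); rewrite /= mulmxBr ker sub0r.
  rewrite -scaleN1r (@snormZ _ row2) normcN ComplexField.Normc.normc1 mul1r => /le_trans; apply.
  by rewrite mulrAC ler_pdivrMr// ler_wpM2l ?(ltW e0)// lerDl.
apply: mvalP => i; rewrite mvalM cE.
have h : (1%:M - L 0) *m mval b i = 0 by rewrite line_proj0_compl -mulmxA ker mulmx0.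
have : adjmx ((1%:M - L 0) *m mval b i) = 0.
  by rewrite h; apply/matrixP => x y; rewrite !mxE conjC0.
rewrite adjmxM adjmxB adjmx1 line_proj_adj pos_ball_adj// mulmxBr mulmx1.
by move/eqP; rewrite subr_eq0 => /eqP.
Qed.

(** The supremum is a maximum: [c] itself lies below [r], and by [down_flat] it absorbs every
    element below [r]. *)
Lemma flat_interior : interior_proj U r = iota c.
Proof.
have [sc cc] := const_cs_proj.
apply: interior_projE; split; first exact: iota_enveloping.
  move=> _ [b [pb br] <-]; apply: compress_le => //; first exact: iota_enveloping.
    by move=> x; rewrite -iotaM cc.
  by move=> x; rewrite -iotaM down_flat.
move=> z _ hz; apply: hz; exists c => //; split; first exact: cs_proj_pos const_cs_proj.
move=> x; rewrite innerBl -[inner (r x) x]mul1r; apply: (slim_ge0 ar); first exact: oner_neq0.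
exists 0%N => N _; rewrite mul1r -innerBl; apply: iota_le_proj.
- exact: const_cs_proj.
- by apply: (trunc_cs_proj _ am) => *; exact: mx_projL.
apply: mvalP => -[[k n]|]; rewrite mvalM am cE /=; last by rewrite mul1mx.
by case: ifP => _; [case: (mx_projL 0) | rewrite mul1mx].
Qed.

End Flat.

(** Truncations of equal rank [N] differ at [(k, n)] by at most [1 / (k + K + 1)], and norm bounds
    pass to strong limits. *)
Lemma flat_tilted K (a a' : nat -> A) (r Q : H -> H) :
  (forall N, mval (a N) = trunc_mx (fun _ _ => L 0) N) ->
  (forall N, mval (a' N) = trunc_mx (tilted K) N) ->
  @slim R A U a r -> @slim R A U a' Q ->
  forall x, rnorm (r x - Q x) <= K.+1%:R^-1 * rnorm x.
Proof.
move=> am am' ar aQ; apply: (slim_diff_le hc ar aQ) => N.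
apply: mval_norm_le; first by rewrite invr_ge0.
move=> i; rewrite mvalB am am'.
have z : opb (1%:M - 1%:M : 'M[C]_2) (K.+1%:R^-1).
  by rewrite subrr; apply: opb_le opb0; rewrite invr_ge0.
case: i => [[k n]|] /=; last exact: z.
case: ifP => _; last exact: z.
apply: opb_le (opb_line_projB _); rewrite norm_tilt.
by rewrite lef_pV2 ?posrE// ler_nat ltnS leq_addl.
Qed.

(** * Comparison of [p] with the tilted and the flat projections *)

Section TailAndTruncations.
Context (b : nat -> A) (bm : forall N, mval (b N) = tail_mx N).
Context (p : H -> H) (bp : @slim R A U b p).

Section Tilted.
Context (K : nat) (a : nat -> A) (am : forall N, mval (a N) = trunc_mx (tilted K) N).
Context (q : H -> H) (aq : @slim R A U a q).

Let xi : H := vvec None ee.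

Let xi_norm : rnorm xi = 1.
Proof. by exact: vvec_norm snorm_e1. Qed.

(** All elements below [q] lie below [cotail p], whose value at [xi] is zero. *)
Lemma tilted_interior : inner (interior_proj U q xi) xi <= 0.
Proof.
apply: (@interior_proj_le _ _ _ _ (cotail p)).
- exact: (cotail_sa bm bp).
- move=> c [pc cq]; apply: (tail_orthogonal bm bp pc).
  exact: (down_tilted am aq pc cq).
by rewrite /cotail (tail_xi bm bp) subrr inner0l.
Qed.

Lemma tilted_not_le : ~ op_le p (interior_proj U q).
Proof.
move=> /(_ xi); rewrite innerBl (tail_xi bm bp) inner_sqr xi_norm expr1n subr_ge0.
by move=> /le_trans/(_ tilted_interior); rewrite lecR ler10.
Qed.

(** Tested at [xi]: since [p] fixes [xi], the form of the image of [xi] and [xi] is [1] minus a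
    nonpositive number. *)
Lemma tilted_c_dist : (1%:E <= c_dist U p q)%E.
Proof.
apply: le_trans (opnorm_ge _ (_ : rnorm xi <= 1)); last by rewrite xi_norm.
rewrite lee_fin /=; set w := p xi - p (interior_proj U q xi).
rewrite -[leRHS]mulr1 -xi_norm; apply: le_trans (inner_CS _ _).
apply: le_trans (Re_le_normc _).
have [_ sap] := tail_sa bm bp.
rewrite /w innerBl sap (tail_xi bm bp) inner_sqr xi_norm sap (tail_xi bm bp).
have := tilted_interior; rewrite -oppr_ge0 => /ge0_Re[_].
by case: (inner _ _) => x y /=; lra.
Qed.

Lemma tail_tilted_dist N (c : A) : up U q c -> dA (b N) c <= (N + K).+1%:R^-1.
Proof.
move=> [pc qc]; apply: mval_norm_le; first by rewrite invr_ge0.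
move=> i; rewrite mvalB mvalM bm.
have z : opb (0 : 'M[C]_2) (N + K).+1%:R^-1 by apply: opb_le opb0; rewrite invr_ge0.
rewrite -[X in opb (X - _)]mulmx1 -mulmxBr.
case: i => [[k n]|] /=.
  case: leqP => Nk; last by rewrite mul0mx.
  apply: opb_line_proj0_mul; apply: (le_trans (up_tilted am aq _ _ pc qc)).
  by rewrite lef_pV2 ?posrE// ler_nat ltnS leq_add2r.
apply: opb_line_proj0_mul; apply/ler_addgt0Pr => e e0.
(* The value at infinity is compared with a row [k'] that is close to it and also in the range where
   [up_tilted] gives the required bound. *)
have [_ [k hk]] := mval_ucont c e0; pose k' := maxn k N.
have -> : 1%:M - mval c None
    = (1%:M - mval c (Some (k', 0%N))) + (mval c (Some (k', 0%N)) - mval c None).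
  by rewrite subrKA.
rewrite mulmxDr; apply: (le_trans (snormD _ _)); apply: lerD.
  apply: (le_trans (up_tilted am aq _ _ pc qc)).
  by rewrite lef_pV2 ?posrE// ler_nat ltnS leq_add2r leq_maxr.
by have := hk k' 0%N (leq_maxl _ _) ee; rewrite snorm_e1 mulr1.
Qed.

Lemma tail_up N : up U p (b N).
Proof.
split; first exact: cs_proj_pos (tail_cs_proj bm N).
exact: (slim_le (tail_cs_proj bm) (tail_decr bm) bp).
Qed.

Lemma tilted_inf :
  ereal_inf [set ereal_sup [set (dA c d)%:E | d in up U q] | c in up U p] = 0%E.
Proof.
apply/eqP; rewrite eq_le; apply/andP; split; last first.
  (* Compactness of [q] makes [up U q] nonempty, so that the inner supremum is not [-oo]. *)
  apply: le_ereal_inf_tmp => _ [c _ <-]; have [_ [d qd] _] := trunc_compact (tilted_proj K) am aq.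
  apply: (@le_trans _ _ (dA c d)%:E); first by rewrite lee_fin rnorm_ge0.
  by apply: ereal_sup_ubound; exists d.
apply/lee_addgt0Pr => e e0; rewrite add0e.
have [N hN] : exists N : nat, e^-1 < N.+1%:R by exists (Num.trunc e^-1); rewrite truncnS_gt.
apply: (@le_trans _ _ (ereal_sup [set (dA (b N) d)%:E | d in up U q])).
  by apply: ereal_inf_lbound; exists (b N) => //; exact: tail_up.
apply: ge_ereal_sup => _ [d qd <-]; rewrite lee_fin; apply: (le_trans (tail_tilted_dist N qd)).
rewrite -[e]invrK lef_pV2 ?posrE ?invr_gt0//; apply: (le_trans (ltW hN)).
by rewrite ler_nat ltnS leq_addr.
Qed.

End Tilted.

Section Flat.
Context (a : nat -> A) (am : forall N, mval (a N) = trunc_mx (fun _ _ => L 0) N).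
Context (r : H -> H) (ar : @slim R A U a r).

(** As [c] absorbs every [b N], it fixes the range of [p]; taking adjoints, [p] composed with
    [iota c] is [p]. *)
Lemma flat_c_dist : (c_dist U p r <= 0)%E.
Proof.
have [c cE] := const_ex (mx_projL 0).
apply: opnorm_le => // x; rewrite mul0r /= (flat_interior am ar cE).
have -> : p (iota c x) = p x; last by rewrite subrr rnorm0.
have [_ sap] := tail_sa bm bp; have [sc _] := const_cs_proj cE.
have cp y : iota c (p y) = p y.
  apply: (slim_mull hc bp); exists 0%N => N _; apply: mvalP => -[[k n]|].
    rewrite mvalM cE bm /=; case: ifP => _; last by rewrite mulmx0.
    by case: (mx_projL 0).
  by rewrite mvalM cE bm /=; case: (mx_projL 0).
apply/eqP; rewrite -subr_eq0; apply/eqP/rnorm0_eq0/eqP; rewrite -sqrf_eq0; apply/eqP.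
apply: complexI; rewrite -inner_sqr; set y := _ - _.
by rewrite innerBl !sap -sc iota_star cp subrr.
Qed.

Lemma flat_e_dist K (a' : nat -> A) (q : H -> H) :
  (forall N, mval (a' N) = trunc_mx (tilted K) N) -> @slim R A U a' q ->
  (e_dist U r q <= (K.+1%:R^-1)%:E)%E.
Proof.
move=> am' aq; apply: opnorm_le; first by rewrite invr_ge0.
exact: (flat_tilted am am' ar aq).
Qed.

End Flat.

End TailAndTruncations.

End Rep.

End Example.

Theorem theorem3p9 (R : realType) :
  (exists (A : cstarAlgebra R) (U : universalRep A)
          (p q : ur_space U -> ur_space U),
     [/\ compact_proj U p, compact_proj U q,
         ereal_inf [set ereal_sup [set (dA a b)%:E | b in up U q] | a in up U p]
           = 0%E
       & ~ op_le p (interior_proj U q)]) /\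
  (exists (A : cstarAlgebra R) (U : universalRep A),
     ~ precapprox (compact_proj U `*` compact_proj U)
         (fun pq => c_dist U pq.1 pq.2) (fun pq => ce_dist U pq.1 pq.2)).
Proof.
have [u u1] := @const_ex R _ mx_proj1; have hu := one_unit u1.
pose U := universal_rep hu.
have hc a x := @universal_rep_le R _ u hu a x.
have hone v (hv : is_unit v) x : @ur_rep _ _ U v x = x.
  have -> : v = u by rewrite -[LHS](hu v).2 (hv u).1.
  exact: universal_rep_unit.
have [b bm] := @tail_ex R.
have [p bp] := slim_exists U (tail_cs_proj bm) (tail_decr bm).
have tl K : exists a Q, (forall N, mval (a N) = trunc_mx (tilted K) N) /\ @slim R _ U a Q.
  have [a am] := trunc_ex (@tilted_proj R K).
  have [Q aQ] := slim_exists U (trunc_cs_proj (tilted_proj K) am) (trunc_decr (tilted_proj K) am).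
  by exists a, Q.
split.
  have [a [q [am aq]]] := tl 0%N; exists _, U, p, q; split.
  - exact: (tail_compact hc bm bp).
  - exact: (trunc_compact hc (tilted_proj 0) am aq).
  - exact: (tilted_inf hc bm bp am aq).
  - exact: (tilted_not_le hc hone bm bp am aq).
(* The choice [eps = 1] is refuted: with [1 / (K + 1) < d], passing through [r] brings
   [ce_dist U p q] below [d], while [c_dist U p q] is at least [1]. *)
exists _, U => /(_ 1 ltr01)[d d0 H].
have [K hK] : exists K : nat, d^-1 < K.+1%:R by exists (Num.trunc d^-1); rewrite truncnS_gt.
have [a [q [am aq]]] := tl K.
have pL (k n : nat) : mx_proj (line_proj (0 : R)) := mx_projL 0.
have [a' am'] := trunc_ex pL.
have [r ar] := slim_exists U (trunc_cs_proj pL am') (trunc_decr pL am').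
have := H (p, q) (conj (tail_compact hc bm bp) (trunc_compact hc (tilted_proj K) am aq)).
have ce : (ce_dist U p q < d%:E)%E.
  apply: (@le_lt_trans _ _ (c_dist U p r + e_dist U r q)%E).
    by apply: ereal_inf_lbound; exists r => //; exact: (trunc_compact hc pL am' ar).
  apply: (@le_lt_trans _ _ (0 + (K.+1%:R^-1)%:E)%E).
    by apply: leeD; [exact: (flat_c_dist hc bm bp am' ar) | exact: (flat_e_dist hc am' ar am aq)].
  by rewrite add0e lte_fin invf_plt ?posrE.
move=> /(_ ce); rewrite ltNge => /negP; apply.
exact: (tilted_c_dist hc hone bm bp am aq).
Qed.
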